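(* Let $G$ be a graph with $kr$ edges, where $r$ is the rank of the cycle matroid $M(G)$, and suppose $k\ge 3$. Then the $k$-base graph $\mathfrak{G}_k(M(G))$ is connected.
   Context: The cycle matroid $M(G)$ of a graph $G$ has ground set $E(G)$ and its bases are the spanning forests of $G$ (maximal acyclic edge subsets); its rank is $|V(G)|$ minus the number of connected components of $G$. For a matroid $M$ of rank $r$ on a ground set of size $rk$, the $k$-base graph $\mathfrak{G}_k(M)$ is the graph whose vertices are the sets $\{B_1,\dots,B_k\}$ of $k$ pairwise disjoint bases of $M$, with an edge between $\{B_1,\dots,B_k\}$ and $\{D_1,\dots,D_k\}$ if and only if $B_i=D_j$ for some $i,j$. *)

(* Defs.v *)
From mathcomp Require Import all_boot.
Set Implicit Arguments. Unset Strict Implicit. Unset Printing Implicit Defensive.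

(* A finite multigraph (loops and parallel edges allowed): vertex type V,
   edge type E, and each edge e has endpoints (ends e).1, (ends e).2. *)
Section Graph.
Variables (V E : finType) (ends : E -> V * V).

Definition adjF (F : {set E}) : rel V :=
  fun x y => [exists e in F, (ends e == (x, y)) || (ends e == (y, x))].

(* degree of v in the subgraph spanned by F (a loop counts twice) *)
Definition degF (F : {set E}) (v : V) : nat :=
  #|[set e in F | (ends e).1 == v]| + #|[set e in F | (ends e).2 == v]|.

Definition is_cycle (C : {set E}) : Prop :=
  [/\ C != set0,
      forall v, (degF C v == 0) || (degF C v == 2)
    & forall e f, e \in C -> f \in C -> connect (adjF C) (ends e).1 (ends f).1].

Definition acyclic (F : {set E}) : Prop :=
  forall C : {set E}, C \subset F -> ~ is_cycle C.

Definition is_base (B : {set E}) : Prop :=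
  acyclic B /\ forall B' : {set E}, B \subset B' -> acyclic B' -> B' = B.

Definition ncomp : nat := n_comp (adjF [set: E]) predT.

Definition cycle_rank : nat := #|V| - ncomp.

Definition kbase_vertex (k : nat) (P : {set {set E}}) : Prop :=
  [/\ #|P| = k, forall B, B \in P -> is_base B & trivIset P].

Definition kbase_adj (k : nat) (P Q : {set {set E}}) : Prop :=
  [/\ kbase_vertex k P, kbase_vertex k Q & exists B, B \in P /\ B \in Q].

Inductive kbase_path (k : nat) : {set {set E}} -> {set {set E}} -> Prop :=
  | kbp_refl P : kbase_path k P P
  | kbp_step P Q R : kbase_adj k P Q -> kbase_path k Q R -> kbase_path k P R.

Definition kbase_graph_connected (k : nat) : Prop :=
  forall P Q, kbase_vertex k P -> kbase_vertex k Q -> kbase_path k P Q.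

End Graph.

(* Main.v *)
Require Import Defs.
From Stdlib Require Import Relation_Operators Operators_Properties.
From mathcomp Require Import all_boot zify.
Set Implicit Arguments. Unset Strict Implicit. Unset Printing Implicit Defensive.

(** Identifying one vertex from each component turns maximal forests into spanning trees, so
    a vertex of the base graph becomes a colouring of the edges whose [k] classes are spanning
    trees, two colourings being adjacent when they share a class. Any two such colourings are
    linked by induction on the number of vertices. Averaging gives a vertex [v] of degree
    [k + s] with [s < k]. Replacing [s] disjoint pairs of edges at [v] by new edges joining
    their other ends, and deleting the remaining edges at [v], leaves a graph on one vertex
    less which is of the same kind. A path between colourings of the smaller graph lifts
    without recolouring the edges away from [v], and two colourings that agree away from [v]
    are linked by rotating edges at [v] through a tree having [v] as a leaf. Hence all
    colourings arising from one choice of pairs are linked.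

    Every colouring can be moved to one in which each tree has degree at most 2 at [v], and
    such a colouring arises from the choice that pairs the two edges of the same tree. By the
    theorem of Nash-Williams a choice of pairs gives a decomposable graph as soon as it
    satisfies a sparsity condition, which is violated only through tight sets; uncrossing
    these shows that any two admissible choices are joined by exchanges of one pair, because
    some edge at [v] always remains unpaired. Finally, an exchange of one pair breaks into at
    most a few exchanges in which some colouring arises from both choices. *)

(** * Connectivity and forests *)

Section EdgeConnectivity.
Variables (V E : finType) (ends : E -> V * V).
Implicit Types (A : {set E}) (e : E) (x y z : V).

Definition econnect A x y := connect (adjF ends A) x y.

Lemma adjFP A x y :
  reflect (exists2 e, e \in A & ends e = (x, y) \/ ends e = (y, x))
          (adjF ends A x y).
Proof.
apply: (iffP existsP) => [[e /andP[eA /orP[/eqP exy|/eqP eyx]]]|[e eA [exy|eyx]]].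
- by exists e => //; left.
- by exists e => //; right.
- by exists e; rewrite eA exy eqxx.
- by exists e; rewrite eA eyx eqxx orbT.
Qed.

Lemma econnect_refl A x : econnect A x x. Proof. exact: connect0. Qed.

Lemma econnect_sym A : symmetric (econnect A).
Proof.
apply: sym_connect_sym => x y.
by apply/adjFP/adjFP => -[e eA [exy|eyx]]; exists e => //; by [right|left].
Qed.

Lemma econnect_trans A : transitive (econnect A).
Proof. by move=> y x z; apply: connect_trans. Qed.

Lemma econnect_eqr A x y z : econnect A x y -> econnect A z x = econnect A z y.
Proof.
move=> xy; apply/idP/idP => z_conn; apply: econnect_trans z_conn _ => //.
by rewrite econnect_sym.
Qed.

Lemma econnect_eql A x y z : econnect A x y -> econnect A x z = econnect A y z.
Proof. by move/econnect_eqr=> xy; rewrite !(econnect_sym A _ z) xy. Qed.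

Lemma econnect_edge A e : e \in A -> econnect A (ends e).1 (ends e).2.
Proof.
by move=> eA; apply: connect1; apply/adjFP; exists e => //; left; case: (ends e).
Qed.

Lemma econnect_closed A (C : pred V) x y :
  {in A, forall e, C (ends e).1 = C (ends e).2} -> econnect A x y -> C x = C y.
Proof.
move=> C_edge; have closedC : closed (adjF ends A) C.
  by move=> a b /adjFP[e /C_edge]; rewrite !unfold_in => eC [] ab; rewrite ab in eC.
exact: (closed_connect closedC).
Qed.

End EdgeConnectivity.

Lemma econnect_map (V V' E E' : finType) (ends : E -> V * V)
    (ends' : E' -> V' * V') (A : {set E}) (B : {set E'}) (h : V -> V') x y :
  {in A, forall e, econnect ends' B (h (ends e).1) (h (ends e).2)} ->
  econnect ends A x y -> econnect ends' B (h x) (h y).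
Proof.
move=> h_edge xy; pose C z := econnect ends' B (h x) (h z).
rewrite -[econnect _ _ _ _]/(C y) -(econnect_closed (C := C) _ xy) => [|e /h_edge].
  exact: econnect_refl.
exact: econnect_eqr.
Qed.

Section Forests.
Variables (V E : finType) (ends : E -> V * V).
Implicit Types (A B D : {set E}) (X : {set V}).
Local Notation econnect := (econnect ends).

Lemma econnectS A B x y : A \subset B -> econnect A x y -> econnect B x y.
Proof.
by move=> /subsetP AB; apply: (econnect_map (h := id)) => e /AB/(econnect_edge ends).
Qed.

Definition avoids (v : V) A :=
  {in A, forall e, ((ends e).1 != v) && ((ends e).2 != v)}.

Lemma avoidsS v A B : A \subset B -> avoids v B -> avoids v A.
Proof. by move=> /subsetP AB avB e /AB/avB. Qed.

Lemma econnect_avoids v w A : avoids v A -> econnect A v w -> w = v.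
Proof.
move=> avA vw; apply/eqP; rewrite -[w == v]/(pred1 v w).
rewrite -(econnect_closed (C := pred1 v) _ vw) /= ?eqxx // => e.
by move=> /avA/andP[/negbTE-> /negbTE->].
Qed.

Lemma econnect_set0 x y : econnect set0 x y = (x == y).
Proof.
apply/idP/eqP => [/econnect_avoids->//|->]; last exact: econnect_refl.
by move=> e; rewrite inE.
Qed.

Lemma econnect_setU1 A e x y : econnect (e |: A) x y ->
  [\/ econnect A x y,
      econnect A x (ends e).1 /\ econnect A (ends e).2 y
    | econnect A x (ends e).2 /\ econnect A (ends e).1 y].
Proof.
set s := (ends e).1; set t := (ends e).2 => xy.
pose C z := econnect A x z ||
  ((econnect A x s || econnect A x t) && (econnect A s z || econnect A t z)).
have : C y.
  rewrite -(econnect_closed (C := C) _ xy) /C ?econnect_refl // => f.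
  rewrite !inE => /orP[/eqP->|/(econnect_edge ends) fA]; last by rewrite !(econnect_eqr _ fA).
  rewrite -/s -/t !econnect_refl !orbT !andbT.
  by case: (econnect A x s); case: (econnect A x t).
case/orP=> [|/andP[/orP[xs|xt] /orP[sy|ty]]]; first by constructor 1.
- by constructor 1; apply: econnect_trans xs sy.
- by constructor 2.
- by constructor 3.
- by constructor 1; apply: econnect_trans xt ty.
Qed.

(* The usual definition by absence of cycles is recovered in [acyclicP]. *)
Definition forest A : Prop :=
  {in A, forall e, ~~ econnect (A :\ e) (ends e).1 (ends e).2}.

Lemma forestS A B : A \subset B -> forest B -> forest A.
Proof.
move=> AB fB e eA; apply: contra (fB e (subsetP AB e eA)).
by apply: econnectS; apply: setSD.
Qed.

Lemma forest_setU1 A e :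
  forest A -> ~~ econnect A (ends e).1 (ends e).2 -> forest (e |: A).
Proof.
move=> fA ne f; rewrite !inE => /orP[/eqP->|fA'].
  apply: contra ne; apply: econnectS; apply/subsetP => g.
  by rewrite !inE => /andP[/negbTE->].
have nef : e != f by apply: contraNneq ne => ->; apply: econnect_edge.
have -> : (e |: A) :\ f = e |: A :\ f.
  by rewrite setDUl; congr (_ :|: _); apply/setDidPl; rewrite disjoints1 inE.
have sub : A :\ f \subset A by apply: subD1set.
have ef := econnect_edge ends fA'.
apply: contra ne => /econnect_setU1[fA''|[/(econnectS sub) fs /(econnectS sub) tf]
                                       |[/(econnectS sub) ft /(econnectS sub) sf]].
- by move: (fA f fA'); rewrite fA''.
- by rewrite -(econnect_eql _ fs) (econnect_eqr _ tf).
- by rewrite econnect_sym -(econnect_eql _ ft) (econnect_eqr _ sf).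
Qed.

Lemma forest_separating_edge A D x y :
  forest A -> econnect A x y -> ~~ econnect (A :\: D) x y ->
  exists g, [/\ g \in D, g \in A & ~~ econnect (A :\ g) x y].
Proof.
move=> fA xyA nD; pose separates B := ~~ econnect (A :\: B) x y.
have [B /minsetP[sepB minB] BD] := minset_exists (nD : separates D).
have [B0|[g gB]] := set_0Vmem B; first by move: sepB; rewrite /separates B0 setD0 xyA.
have xyg : econnect (A :\: (B :\ g)) x y.
  apply: contraTT gB => nB; rewrite -(minB _ nB (subD1set B g)).
  by rewrite !inE eqxx.
have gA : g \in A.
  apply: contraNT sepB => gA; apply: econnectS xyg; apply/subsetP => f.
  by rewrite !inE; case: (eqVneq f g) => [->|//]; rewrite (negbTE gA) andbF.
exists g; split=> //; first exact: (subsetP BD).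
have eqB : A :\: (B :\ g) = g |: (A :\: B).
  apply/setP => f; rewrite !inE negb_and negbK andb_orl.
  by case: (eqVneq f g) => //= ->; rewrite gA.
have sub : A :\: B \subset A :\ g by apply: setDS; rewrite sub1set.
apply: contra (fA g gA) => xyAg; rewrite eqB in xyg.
case/econnect_setU1: xyg => [xyB|[/(econnectS sub) xs /(econnectS sub) ty]
                                |[/(econnectS sub) xt /(econnectS sub) sy]].
- by rewrite /separates xyB in sepB.
- by rewrite -(econnect_eql _ xs) (econnect_eqr _ ty).
- by rewrite (econnect_eql _ sy) -(econnect_eqr _ xt) econnect_sym.
Qed.

Definition within A X : Prop := {in A, forall e, (ends e).1 \in X /\ (ends e).2 \in X}.

Definition induced A X := [set e in A | ((ends e).1 \in X) && ((ends e).2 \in X)].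

Lemma induced_sub A X : induced A X \subset A.
Proof. by apply/subsetP => e; rewrite inE => /andP[]. Qed.

Lemma induced_within A X : within (induced A X) X.
Proof. by move=> e; rewrite inE => /and3P[]. Qed.

Lemma induced_id A X : within A X -> induced A X = A.
Proof. by move=> AX; apply/setP => e; rewrite inE andb_idr // => /AX[-> ->]. Qed.

Lemma card_induced_super A X Y :
  #|induced A X| + #|induced A Y| <=
  #|induced A (X :|: Y)| + #|induced A (X :&: Y)|.
Proof.
rewrite -cardsUI; apply: leq_add; apply: subset_leq_card; apply/subsetP => e.
  by rewrite !inE => /orP[] /and3P[-> -> ->]; rewrite ?orbT.
by rewrite !inE => /andP[/and3P[-> -> ->] /and3P[_ -> ->]].
Qed.

Definition component A x := [set y | econnect A x y].

Definition components A X := component A @: X.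

Lemma eq_component A x y : (component A x == component A y) = econnect A x y.
Proof.
apply/eqP/idP => [/setP/(_ y)|xy].
  by rewrite !inE econnect_refl.
by apply/setP => z; rewrite !inE (econnect_eql _ xy).
Qed.

Lemma component_setU1 A e x :
  let s := (ends e).1 in let t := (ends e).2 in
  component (e |: A) x =
    if (s \in component A x) || (t \in component A x)
    then component A s :|: component A t else component A x.
Proof.
move=> s t; have sub : A \subset e |: A by apply: subsetUr.
have st := econnect_edge ends (setU11 e A).
have xs z : econnect A x s || econnect A x t ->
    econnect (e |: A) x z = econnect (e |: A) s z.
  case/orP=> /(econnectS sub) /econnect_eql ->; first by [].
  by rewrite (econnect_eql _ st).
apply/setP => y; rewrite !inE; case: ifP => [/xs->|/norP[nxs nxt]].
  rewrite !inE; apply/idP/orP => [/econnect_setU1[|[_]|[_]]|[|]]; try by [left|right].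
    exact: econnectS.
  by move/(econnectS sub); rewrite -(econnect_eql _ st).
rewrite inE; apply/idP/idP => [/econnect_setU1[//|[xs' _]|[xt _]]|]; last exact: econnectS.
  by rewrite xs' in nxs.
by rewrite xt in nxt.
Qed.

Lemma card_components_setU1 A X e :
  (ends e).1 \in X -> (ends e).2 \in X -> ~~ econnect A (ends e).1 (ends e).2 ->
  #|components A X| = #|components (e |: A) X|.+1.
Proof.
set s := (ends e).1; set t := (ends e).2 => sX tX nst.
pose merge (C : {set V}) :=
  if (s \in C) || (t \in C) then component A s :|: component A t else C.
have mergeE x : component (e |: A) x = merge (component A x) by apply: component_setU1.
have tP : component A t \in components A X by apply: imset_f.
have sP : component A s \in components A X :\ component A t.
  by rewrite !inE eq_component nst imset_f.
have merged_eq (C : {set V}) : C \in components A X :\ component A t ->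
    (s \in C) || (t \in C) -> C = component A s.
  rewrite !inE => /andP[nCt /imsetP[x _ eC]]; move: nCt; rewrite eC eq_component !inE.
  by move=> /negbTE->; rewrite orbF -eq_component => /eqP.
have -> : components (e |: A) X = merge @: (components A X :\ component A t).
  apply/eqP; rewrite eqEsubset; apply/andP; split; apply/subsetP => C.
    case/imsetP=> x xX ->; rewrite mergeE.
    have [ext|next] := eqVneq (component A x) (component A t).
      apply/imsetP; exists (component A s) => //.
      by rewrite ext /merge !inE !econnect_refl orbT.
    by apply: imset_f; rewrite !inE next imset_f.
  case/imsetP=> B; rewrite inE => /andP[_ /imsetP[x xX ->]] ->.
  by rewrite -mergeE imset_f.
rewrite card_in_imset => [|B C BP CP]; first by rewrite (cardsD1 (component A t)) tP.
rewrite /merge.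
case: ifP => [/(merged_eq _ BP)->|nB]; case: ifP => [/(merged_eq _ CP)-> //|nC] //.
  by move=> eC; move: nC; rewrite -eC !inE econnect_refl.
by move=> eB; move: nB; rewrite eB !inE econnect_refl.
Qed.

Lemma forest_card_components A X : forest A -> within A X ->
  #|X| = #|A| + #|components A X|.
Proof.
have [n] := ubnP #|A|; elim: n A => // n IH A leA fA AX.
have [->|[e eA]] := set_0Vmem A.
  rewrite cards0 card_imset // => x y /eqP; rewrite eq_component econnect_set0.
  by move/eqP.
have [sX tX] := AX e eA; rewrite (cardsD1 e A) eA in leA *.
have := card_components_setU1 sX tX (fA e eA); rewrite setD1K // => cA.
rewrite (IH (A :\ e)) ?cA //; first by rewrite addnS.
  exact: forestS (subD1set _ _) fA.
by move=> f; rewrite inE => /andP[_ /AX].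
Qed.

Lemma forest_card_induced A X : forest A -> X != set0 -> #|induced A X| < #|X|.
Proof.
move=> fA /set0Pn[x xX].
rewrite (forest_card_components (forestS (induced_sub A X) fA) (@induced_within A X)).
rewrite -[X in X < _]addn0 ltn_add2l; apply/card_gt0P.
by exists (component (induced A X) x); apply: imset_f.
Qed.

Lemma forest_card_connected A X : forest A -> within A X ->
  #|X| <= #|A|.+1 -> {in X &, forall x y, econnect A x y}.
Proof.
move=> fA AX; rewrite (forest_card_components fA AX) -addn1 leq_add2l => le1 x y xX yX.
by rewrite -eq_component; apply/eqP/(card_le1_eqP le1); apply: imset_f.
Qed.

End Forests.

(** * Colourings whose classes are forests *)

Section ColorClasses.
Variables (E : finType) (k : nat).
Implicit Types (S : {set E}) (c : E -> 'I_k) (i j : 'I_k).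

Definition color_class S c i := [set e in S | c e == i].

Lemma in_color_class S c i e : (e \in color_class S c i) = (e \in S) && (c e == i).
Proof. by rewrite inE. Qed.

Lemma color_class_sub S c i : color_class S c i \subset S.
Proof. by apply/subsetP => e; rewrite inE => /andP[]. Qed.

Lemma eq_color_classP S c c' i :
  color_class S c i = color_class S c' i <-> {in S, forall e, (c e == i) = (c' e == i)}.
Proof.
split=> [/setP eqc e eS|eqc]; first by have := eqc e; rewrite !inE eS.
by apply/setP => e; rewrite !inE; case eS: (e \in S); rewrite //= eqc.
Qed.

Lemma eq_color_class S c c' i :
  {in S, c =1 c'} -> color_class S c i = color_class S c' i.
Proof. by move=> cc'; apply/eq_color_classP => e /cc'->. Qed.

Lemma color_class_setU1 S c e i :
  color_class (e |: S) c i =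
    if c e == i then e |: color_class S c i else color_class S c i.
Proof.
case: ifP => cei; apply/setP => f; rewrite !inE; case: eqVneq => //= ->; rewrite cei //.
by rewrite andbF.
Qed.

Lemma sum_card_color_class S c : \sum_i #|color_class S c i| = #|S|.
Proof.
rewrite -[RHS]sum1_card (partition_big c predT) //=; apply: eq_bigr => i _.
by rewrite -sum1_card; apply: eq_bigl => e; rewrite inE.
Qed.

Lemma coloring_of_family (T : 'I_k -> {set E}) : 0 < k ->
  (forall i j e, e \in T i -> e \in T j -> i = j) ->
  exists c, forall i, color_class (\bigcup_i T i) c i = T i.
Proof.
move=> k_gt0 disjT; exists (fun e => odflt (Ordinal k_gt0) [pick i | e \in T i]) => i.
apply/setP => e; rewrite inE; case: pickP => [j eTj|noT] /=.
  have -> : e \in \bigcup_i T i by apply/bigcupP; exists j.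
  by apply/eqP/idP => [<- //|eTi]; apply: disjT eTj eTi.
by rewrite noT; case: bigcupP => // -[j _]; rewrite noT.
Qed.

Definition swap_colors c y z := [eta c with y |-> c z, z |-> c y].

Lemma color_class_swap S c y z j : y \in S -> z \in S -> c y != c z ->
  color_class S (swap_colors c y z) j =
    if j == c z then y |: (color_class S c (c z) :\ z)
    else if j == c y then z |: (color_class S c (c y) :\ y)
    else color_class S c j.
Proof.
move=> yS zS cyz; have yz : y != z by apply: contraNneq cyz => ->.
apply/setP => e; rewrite [LHS]inE /=; have [->|ey] := eqVneq e y.
  rewrite yS /= (eq_sym (c z)); case: ifP => [_|jz]; first by rewrite !inE eqxx.
  by case: ifP => jy; rewrite !inE ?eqxx ?(negbTE yz) // yS eq_sym jy.
have [->|ez] := eqVneq e z.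
  rewrite zS /= (eq_sym (c y)); case: ifP => [/eqP->|jz].
    by rewrite !inE eqxx eq_sym (negbTE cyz) eq_sym (negbTE yz).
  by case: ifP => jy; rewrite !inE ?eqxx // zS eq_sym jz.
by case: ifP => [/eqP->|_]; [|case: ifP => [/eqP->|_]];
  rewrite !inE ?(negbTE ey) ?(negbTE ez).
Qed.

End ColorClasses.

Section ForestColorings.
Variables (V E : finType) (ends : E -> V * V) (k : nat).
Implicit Types (S : {set E}) (X : {set V}) (c : E -> 'I_k) (i j : 'I_k).

Definition forest_coloring S c : Prop := forall i, forest ends (color_class S c i).

Definition sparse S : Prop := forall X, X != set0 -> #|induced ends S X| <= k * #|X|.-1.

Lemma forest_coloring_sparse S c : forest_coloring S c -> sparse S.
Proof.
move=> fc X X0; rewrite -(sum_card_color_class _ c) -[X in X * _]card_ord -sum_nat_const.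
apply: leq_sum => i _.
have -> : color_class (induced ends S X) c i = induced ends (color_class S c i) X.
  by apply/setP => e; rewrite !inE andbAC.
by have := forest_card_induced (fc i) X0; case: #|X|.
Qed.

Lemma sparse_loopless S : sparse S -> {in S, forall e, (ends e).1 != (ends e).2}.
Proof.
move=> spS e eS; apply/negP => /eqP loop.
have /spS : [set (ends e).1] != set0 by apply/set0Pn; exists (ends e).1; rewrite inE.
rewrite cards1 muln0 leqn0 cards_eq0 => /eqP/setP/(_ e).
by rewrite !inE eS -loop eqxx.
Qed.

Section Tight.
Variables (S : {set E}) (X : {set V}) (c : E -> 'I_k).
Hypothesis X0 : 0 < #|X|.
Hypothesis S_within : within ends S X.
Hypothesis cardS : #|S| = k * #|X|.-1.

Let class_within i : within ends (color_class S c i) X.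
Proof. by move=> e; rewrite inE => /andP[/S_within]. Qed.

Lemma card_tight_color_class i : forest_coloring S c -> #|color_class S c i| = #|X|.-1.
Proof.
move=> fc; have card_le j : true ->
    #|color_class S c j| <= #|X|.-1 ?= iff (#|color_class S c j| == #|X|.-1).
  move=> _; split=> //; have := forest_card_induced (fc j) (_ : X != set0).
  by rewrite induced_id // -card_gt0 => /(_ X0); case: #|X| X0.
have := leqif_sum card_le; rewrite sum_card_color_class sum_nat_const card_ord cardS.
by case=> _; rewrite eqxx => /esym/forallP/(_ i)/eqP.
Qed.

Lemma tight_color_class_spans i : forest_coloring S c ->
  {in X &, forall x y, econnect ends (color_class S c i) x y}.
Proof.
move=> fc; apply: forest_card_connected (fc i) _ _; first exact: class_within.
by rewrite card_tight_color_class ?prednK.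
Qed.

End Tight.

Definition coloring_step S c c' : Prop :=
  [/\ forest_coloring S c, forest_coloring S c'
    & exists i, color_class S c i = color_class S c' i].

Definition coloring_path S := clos_refl_trans _ (coloring_step S).

Lemma coloring_path_sym S c c' : coloring_path S c c' -> coloring_path S c' c.
Proof.
elim=> [{}c {}c' [fc fc' [i ei]]|{}c|c1 c2 c3 _ IH12 _ IH23].
- by apply: rt_step; split=> //; exists i.
- exact: rt_refl.
- exact: rt_trans IH23 IH12.
Qed.

Lemma exists_third_color i j : 2 < k -> exists l, (l != i) && (l != j).
Proof.
move=> k_gt2; have /subsetPn[l _] : ~~ ([set: 'I_k] \subset [set i; j]).
  apply: contraTN k_gt2 => /subset_leq_card; rewrite cardsT card_ord cards2 -leqNgt.
  by move/leq_trans; apply; case: (_ != _).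
by rewrite !inE negb_or; exists l.
Qed.

Lemma swap_colors_step S c y z : 2 < k -> forest_coloring S c ->
  y \in S -> z \in S -> c y != c z ->
  ~~ econnect ends (color_class S c (c z) :\ z) (ends y).1 (ends y).2 ->
  ~~ econnect ends (color_class S c (c y) :\ y) (ends z).1 (ends z).2 ->
  coloring_step S c (swap_colors c y z).
Proof.
move=> k_gt2 fc yS zS cyz ny nz; split=> // [j|].
  rewrite color_class_swap //; case: ifP => _; last case: ifP => _ //.
    by apply: forest_setU1 ny; apply: forestS (fc _); apply: subD1set.
  by apply: forest_setU1 nz; apply: forestS (fc _); apply: subD1set.
have [j /andP[jy jz]] := exists_third_color (c y) (c z) k_gt2; exists j.
by rewrite color_class_swap // (negbTE jy) (negbTE jz).
Qed.

End ForestColorings.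

(** * Tight sets of a supermodular load *)

Section Loads.
Variables (V D : finType) (u : D -> V) (k : nat).
Implicit Types (load : {set V} -> nat) (p q : D * D) (X Y Z : {set V}) (x y z : D).

(* In the application [D] is the set of edges at a vertex, [u] gives their other ends and
   [load X] counts the remaining edges inside [X]; a pair of points of [D] stands for a
   new edge between its two images. *)
Definition supermodular load : Prop :=
  forall X Y, load X + load Y <= load (X :|: Y) + load (X :&: Y).

Definition sparse_load load := [forall X, (X != set0) ==> (load X <= k * #|X|.-1)].

Definition tight load X := load X == k * #|X|.-1.

Definition inside p X := (u p.1 \in X) && (u p.2 \in X).

Definition add_pair p load X := inside p X + load X.

Lemma sparse_loadP load :
  reflect (forall X, X != set0 -> load X <= k * #|X|.-1) (sparse_load load).
Proof.
by apply: (iffP forallP) => sp X; [move/implyP: (sp X)|apply/implyP; apply: sp].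
Qed.

Lemma eq_sparse_load load load' : load =1 load' -> sparse_load load = sparse_load load'.
Proof. by move=> e; apply: eq_forallb => X; rewrite e. Qed.

Lemma supermodular_add_pair p load : supermodular load -> supermodular (add_pair p load).
Proof.
move=> super X Y; rewrite /add_pair /inside !inE; move: (super X Y).
by case: (u p.1 \in X); case: (u p.1 \in Y); case: (u p.2 \in X);
  case: (u p.2 \in Y) => /=; lia.
Qed.

Lemma add_pair_swap x y load : add_pair (y, x) load =1 add_pair (x, y) load.
Proof. by move=> X; rewrite /add_pair /inside andbC. Qed.

Lemma add_pairC p q load : add_pair p (add_pair q load) =1 add_pair q (add_pair p load).
Proof. by move=> X; rewrite /add_pair addnCA. Qed.

Lemma sparse_load_pair p load : sparse_load (add_pair p load) -> sparse_load load.
Proof.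
move=> /sparse_loadP sp; apply/sparse_loadP => X /sp; apply: leq_trans.
exact: leq_addl.
Qed.

Lemma tight_not_inside p load X :
  sparse_load (add_pair p load) -> tight load X -> ~~ inside p X.
Proof.
move=> /sparse_loadP sp /eqP tX; apply/negP => pX.
have X0 : X != set0 by apply/set0Pn; exists (u p.1); case/andP: pX.
by have := sp X X0; rewrite /add_pair pX tX add1n ltnn.
Qed.

Lemma tight_add_pair p load X :
  sparse_load (add_pair p load) -> tight load X -> tight (add_pair p load) X.
Proof. by move=> sp tX; rewrite /tight /add_pair (negbTE (tight_not_inside sp tX)). Qed.

Lemma tight_outside p load X : ~~ inside p X -> tight (add_pair p load) X = tight load X.
Proof. by rewrite /tight /add_pair => /negbTE->. Qed.

Lemma sparse_load_blocked p load :
  sparse_load load -> ~~ sparse_load (add_pair p load) ->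
  exists2 X, tight load X & inside p X.
Proof.
move=> /sparse_loadP sp; rewrite negb_forall => /existsP[X].
rewrite negb_imply -ltnNge /add_pair => /andP[X0].
case pX: (inside p X) => lt; last by have := sp X X0; rewrite leqNgt lt.
by exists X => //; rewrite /tight eqn_leq sp // -ltnS.
Qed.

Section Uncrossing.
Variable load : {set V} -> nat.
Hypotheses (super : supermodular load) (sp : sparse_load load).

Lemma tightUI X Y w : tight load X -> tight load Y -> w \in X -> w \in Y ->
  tight load (X :|: Y) && tight load (X :&: Y).
Proof.
move=> /eqP tX /eqP tY wX wY; have := super X Y; rewrite tX tY /tight.
have wI : w \in X :&: Y by rewrite inE wX.
have wU : w \in X :|: Y by rewrite inE wX.
have load_le (A : {set V}) : w \in A -> load A <= k * #|A|.-1.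
  by move=> wA; apply: (sparse_loadP _ sp); apply/set0Pn; exists w.
have := load_le _ wI; have := load_le _ wU.
suff : k * #|X|.-1 + k * #|Y|.-1 = k * #|X :|: Y|.-1 + k * #|X :&: Y|.-1 by lia.
rewrite -!mulnDr; congr (_ * _); have := cardsUI X Y.
by move: (cardsD1 w X) (cardsD1 w Y) (cardsD1 w (X :&: Y)) (cardsD1 w (X :|: Y));
  rewrite wX wY wI wU; lia.
Qed.

Lemma tightU X Y w : tight load X -> tight load Y -> w \in X -> w \in Y ->
  tight load (X :|: Y).
Proof. by move=> tX tY wX /(tightUI tX tY wX)/andP[]. Qed.

(* Lying in a common tight set is transitive. *)
Lemma sparse_load_alt x y z : sparse_load (add_pair (x, y) load) ->
  sparse_load (add_pair (x, z) load) || sparse_load (add_pair (y, z) load).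
Proof.
move=> sxy; apply/negPn/negP; rewrite negb_or => /andP[].
case/(sparse_load_blocked sp) => X tX /andP[/= xX zX].
case/(sparse_load_blocked sp) => Y tY /andP[/= yY zY].
by have := tight_not_inside sxy (tightU tX tY zX zY); rewrite /inside !inE xX yY orbT.
Qed.

Definition minimal_tight p X := [/\ tight load X, inside p X
  & forall Y, tight load Y -> inside p Y -> X \subset Y].

Lemma ex_minimal_tight p : ~~ sparse_load (add_pair p load) -> exists X, minimal_tight p X.
Proof.
case/(sparse_load_blocked sp) => X1 tX1 pX1; pose around X := tight load X && inside p X.
have aroundX1 : around X1 by rewrite /around tX1.
have [X /minsetP[/andP[tX pX] minX] _] := minset_exists aroundX1.
exists X; split=> // Y tY pY; apply/setIidPl; apply: minX; last exact: subsetIl.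
case/andP: pX pY => p1X p2X /andP[p1Y p2Y].
by have /andP[_ tI] := tightUI tX tY p1X p1Y; rewrite /around tI /inside !inE p1X p2X p1Y.
Qed.

End Uncrossing.

(* A minimal tight set plays the role of a fundamental circuit. *)
Lemma sparse_load_exchange p q load X : supermodular load ->
  sparse_load (add_pair q load) -> minimal_tight (add_pair q load) p X -> inside q X ->
  sparse_load (add_pair p load).
Proof.
move=> super sq [_ _ minX] qX; apply/negPn/negP.
case/(sparse_load_blocked (sparse_load_pair sq)) => Y tY pY.
have /subsetP XY := minX Y (tight_add_pair sq tY) pY.
by have := tight_not_inside sq tY; case/andP: qX => /XY q1Y /XY q2Y; rewrite /inside q1Y q2Y.
Qed.

Lemma eq_minimal_tight load load' p X :
  load =1 load' -> minimal_tight load p X -> minimal_tight load' p X.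
Proof.
by move=> e [tX pX minX]; split=> // [|Y]; [|move: (minX Y)]; rewrite /tight -!e.
Qed.

Lemma sparse_load_walk_start load q X x1 x2 x3 : supermodular load ->
  sparse_load (add_pair (x2, x3) (add_pair q load)) ->
  tight (add_pair q load) X -> inside (x1, x2) X ->
  sparse_load (add_pair (x1, x3) (add_pair q load)).
Proof.
move=> super s23 tX /andP[/= x1X x2X]; apply/negPn/negP.
have sq := sparse_load_pair s23.
case/(sparse_load_blocked sq) => Y tY /andP[/= x1Y x3Y].
have tU := tightU (supermodular_add_pair q super) sq tX tY x1X x1Y.
by have := tight_not_inside s23 tU; rewrite /inside !inE /= x2X x3Y orbT.
Qed.

Lemma sparse_load_walk_alt load X x1 x2 x3 a b : supermodular load ->
  sparse_load (add_pair (x2, x3) (add_pair (a, b) load)) ->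
  tight (add_pair (a, b) load) X -> inside (x1, x2) X ->
  sparse_load (add_pair (x1, x3) (add_pair (x2, a) load)) ||
  sparse_load (add_pair (x1, x3) (add_pair (x2, b) load)).
Proof.
move=> super s23 tX i12; have := sparse_load_walk_start super s23 tX i12.
rewrite (eq_sparse_load (add_pairC _ _ _)) => sab; have s13 := sparse_load_pair sab.
have swap x : sparse_load (add_pair (x, x2) (add_pair (x1, x3) load)) =
              sparse_load (add_pair (x1, x3) (add_pair (x2, x) load)).
  rewrite (eq_sparse_load (add_pairC _ _ _)); apply: eq_sparse_load => Y.
  by congr (_ + _); apply: add_pair_swap.
by rewrite -!swap; apply: (sparse_load_alt (supermodular_add_pair _ super) s13 _ sab).
Qed.

Lemma sparse_load_walk load X x1 x2 x3 x4 x5 : supermodular load ->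
  sparse_load (add_pair (x2, x3) (add_pair (x4, x5) load)) ->
  minimal_tight (add_pair (x4, x5) load) (x1, x2) X -> inside (x4, x5) X ->
  sparse_load (add_pair (x1, x3) (add_pair (x2, x4) load)) ->
  sparse_load (add_pair (x3, x5) (add_pair (x2, x4) load)) /\
  sparse_load (add_pair (x3, x5) (add_pair (x1, x2) load)).
Proof.
move=> super s23 mX i45 s13; have s45 := sparse_load_pair s23.
have [tX /andP[/= x1X x2X] _] := mX; have /andP[/= x4X x5X] := i45.
have tightX p : inside p X -> tight (add_pair p load) X.
  by move=> pX; move: tX; rewrite /tight /add_pair pX i45.
split; apply/negPn/negP.
  have s24 := sparse_load_pair s13.
  case/(sparse_load_blocked s24) => Y tY /andP[/= x3Y x5Y].
  have tX' : tight (add_pair (x2, x4) load) X by apply: tightX; rewrite /inside x2X.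
  have tU := tightU (supermodular_add_pair _ super) s24 tX' tY x5X x5Y.
  by have := tight_not_inside s13 tU; rewrite /inside !inE /= x1X x3Y orbT.
have s12 : sparse_load (add_pair (x1, x2) load) by apply: sparse_load_exchange s45 mX i45.
case/(sparse_load_blocked s12) => Y tY /andP[/= x3Y x5Y].
have tX' : tight (add_pair (x1, x2) load) X by apply: tightX; rewrite /inside x1X.
have tU := tightU (supermodular_add_pair _ super) s12 tX' tY x5X x5Y.
have tU' : tight (add_pair (x4, x5) load) (X :|: Y).
  by move: tU; rewrite /tight /add_pair /inside !inE x1X x2X x4X x5X.
by have := tight_not_inside s23 tU'; rewrite /inside !inE /= x2X x3Y orbT.
Qed.

Definition maximal_tight load Z : Prop :=
  tight load Z /\ forall Y, tight load Y -> Z \subset Y -> Y = Z.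

Lemma eq_maximal_tight load load' Z :
  load =1 load' -> maximal_tight load Z -> maximal_tight load' Z.
Proof.
by move=> e [tZ maxZ]; split=> [|Y]; [|move: (maxZ Y)]; rewrite /tight -!e.
Qed.

(* Once all free points lie in a maximal tight set, a pair avoiding that set can
   be broken up so as to pair each of its two points with a free one. *)
Lemma sparse_load_regroup load a b x y Z : supermodular load ->
  sparse_load (add_pair (a, b) load) ->
  maximal_tight (add_pair (a, b) load) Z -> u x \in Z -> u y \in Z ->
  u a \notin Z -> u b \notin Z ->
  sparse_load (add_pair (b, x) load) ->
  sparse_load (add_pair (a, y) (add_pair (b, x) load)).
Proof.
move=> super sab [tZ maxZ] xZ yZ aZ bZ sbx; apply/negPn/negP.
case/(sparse_load_blocked sbx) => Y tY /andP[/= aY yY].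
have tZ' : tight (add_pair (b, x) load) Z.
  by move: tZ; rewrite !tight_outside // /inside /= ?(negbTE aZ) ?(negbTE bZ).
have tU := tightU (supermodular_add_pair _ super) sbx tZ' tY yZ yY.
have tU' : tight (add_pair (a, b) load) (Z :|: Y).
  by move: tU; rewrite /tight /add_pair /inside !inE /= aY xZ orbT andbT.
have eU := maxZ _ tU' (subsetUl _ _).
by case/negP: aZ; rewrite -eU inE aY orbT.
Qed.

End Loads.

(** * Pairings *)

Lemma perm_swap2 (T : eqType) (x y : T) s : perm_eq [:: x, y & s] [:: y, x & s].
Proof. exact: permEl (perm_catCA [:: x] [:: y] s). Qed.

Section Pairings.
Variables (V D : finType) (u : D -> V) (k : nat).
Implicit Types (T : {set D}) (load : {set V} -> nat) (F G H Q : seq (D * D)).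
Implicit Types (p q : D * D) (X Y Z : {set V}) (x y z : D).

Definition endpoints F := flatten [seq [:: p.1; p.2] | p <- F].

Definition pairing T F := uniq (endpoints F) && all [in T] (endpoints F).

Definition pair_load load F : {set V} -> nat := foldr (add_pair u) load F.

Definition admissible T load F := pairing T F && sparse_load k (pair_load load F).

Lemma endpoints_cons p F : endpoints (p :: F) = [:: p.1, p.2 & endpoints F].
Proof. by []. Qed.

Lemma mem_endpoints F p : p \in F -> (p.1 \in endpoints F) && (p.2 \in endpoints F).
Proof.
by move=> pF; apply/andP; split; apply/flatten_mapP; exists p; rewrite ?inE ?eqxx ?orbT.
Qed.

Lemma endpointsP F x :
  reflect (exists2 p, p \in F & x \in [:: p.1; p.2]) (x \in endpoints F).
Proof. exact: flatten_mapP. Qed.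

Lemma size_endpoints F : size (endpoints F) = 2 * size F.
Proof. by elim: F => // p F /= ->; rewrite mulnS. Qed.

Lemma pair_loadE load F X : pair_load load F X = count (fun p => inside u p X) F + load X.
Proof. by elim: F => //= p F IH; rewrite {1}/add_pair IH addnA. Qed.

Lemma perm_endpoints F G : perm_eq F G -> perm_eq (endpoints F) (endpoints G).
Proof. by move=> FG; apply: perm_flatten; apply: perm_map. Qed.

Lemma perm_pair_load load F G : perm_eq F G -> pair_load load F =1 pair_load load G.
Proof. by move=> FG X; rewrite !pair_loadE (seq.permP FG). Qed.

Lemma perm_pairing T F G : perm_eq F G -> pairing T F = pairing T G.
Proof.
by move/perm_endpoints=> FG; rewrite /pairing (perm_uniq FG) (perm_all _ FG).
Qed.

Lemma perm_admissible T load F G : perm_eq F G -> admissible T load F = admissible T load G.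
Proof.
move=> FG; rewrite /admissible (perm_pairing T FG).
by rewrite (eq_sparse_load _ (perm_pair_load load FG)).
Qed.

Lemma pairing_cons T p F : pairing T (p :: F) =
  [&& p.1 != p.2, p.1 \in T, p.2 \in T, p.1 \notin endpoints F, p.2 \notin endpoints F
    & pairing T F].
Proof.
rewrite /pairing /= inE negb_or.
by case: (p.1 == p.2); case: (p.1 \in T); case: (p.2 \in T); rewrite /= ?andbF // -!andbA;
  case: (p.1 \notin _); rewrite // andbCA.
Qed.

Lemma pairing_swap T x y F : pairing T ((x, y) :: F) = pairing T ((y, x) :: F).
Proof.
by congr (_ && _); [apply: perm_uniq|apply: perm_all]; apply: perm_swap2.
Qed.

Lemma admissible_swap T load x y F :
  admissible T load ((x, y) :: F) = admissible T load ((y, x) :: F).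
Proof.
by rewrite /admissible pairing_swap (eq_sparse_load _ (add_pair_swap u y x _)).
Qed.

Lemma pairing_mem T F p : pairing T F -> p \in F -> p.1 \in T /\ p.2 \in T.
Proof. by move=> /andP[_ /allP FT] /mem_endpoints/andP[/FT-> /FT->]. Qed.

Lemma pairing_neq T F p : pairing T F -> p \in F -> p.1 != p.2.
Proof.
elim: F => // q F IH; rewrite pairing_cons in_cons => /and5P[nq _ _ _ /andP[_ pF]].
by case/orP=> [/eqP->|/(IH pF)].
Qed.

Lemma pairing_inj T F p q x : pairing T F -> p \in F -> q \in F ->
  x \in [:: p.1; p.2] -> x \in [:: q.1; q.2] -> p = q.
Proof.
elim: F => // r F IH; rewrite pairing_cons => /and5P[_ _ _ r1 /andP[r2 pF]].
have notF s y : s \in F -> y \in [:: s.1; s.2] -> y \notin [:: r.1; r.2].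
  move=> /mem_endpoints/andP[s1 s2]; rewrite !inE => ys; apply: contraNN r1 => yr.
  have yF : y \in endpoints F by case/orP: ys => /eqP->.
  by case/orP: yr => /eqP yr; rewrite yr // in yF *; rewrite yF in r2.
rewrite !in_cons => /orP[/eqP->|pF'] /orP[/eqP->|qF'] // xp xq; last exact: IH xp xq.
  by case/negP: (notF q x qF' xq).
by case/negP: (notF p x pF' xp).
Qed.

Lemma pairing_uniq T F : pairing T F -> uniq F.
Proof.
elim: F => // p F IH; rewrite pairing_cons => /and5P[_ _ _ p1 /andP[_ /IH/= ->]].
by rewrite andbT; apply: contra p1 => /mem_endpoints/andP[].
Qed.

Lemma pairing_filter T F (a : pred (D * D)) : pairing T F -> pairing T (filter a F).
Proof.
elim: F => //= p F IH; rewrite pairing_cons => /and5P[np p1T p2T p1 /andP[p2 /IH pF]].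
have sub : {subset endpoints (filter a F) <= endpoints F}.
  move=> x /endpointsP[q]; rewrite mem_filter => /andP[_ qF] xq.
  by apply/endpointsP; exists q.
by case: ifP => // _; rewrite pairing_cons np p1T p2T (contra (@sub _)) // (contra (@sub _)).
Qed.

Lemma supermodular_pair_load load F : supermodular load -> supermodular (pair_load load F).
Proof. by move=> super; elim: F => // p F; apply: supermodular_add_pair. Qed.

Lemma admissible_cons T load p F : admissible T load (p :: F) =
  [&& p.1 != p.2, p.1 \in T, p.2 \in T & admissible (T :\ p.1 :\ p.2) (add_pair u p load) F].
Proof.
rewrite /admissible pairing_cons; have -> : pairing (T :\ p.1 :\ p.2) F =
    [&& p.1 \notin endpoints F, p.2 \notin endpoints F & pairing T F].
  rewrite /pairing [RHS]andbCA [RHS]andbA andbCA; congr (_ && _).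
  elim: (endpoints F) => //= x s ->; rewrite !inE !negb_or !(eq_sym x).
  by case: (p.2 == x); case: (p.1 == x); case: (x \in T); rewrite /= ?andbF.
have e : pair_load load (p :: F) =1 pair_load (add_pair u p load) F.
  by move=> X; rewrite /= /add_pair !pair_loadE addnCA.
by rewrite (eq_sparse_load _ e) -!andbA.
Qed.

Definition free T F := [set x in T | x \notin endpoints F].

Lemma card_free T F : #|T| - 2 * size F <= #|free T F|.
Proof.
rewrite -size_endpoints leq_subLR; apply: leq_trans (leq_add (card_size _) (leqnn _)).
rewrite -cardUI; apply: leq_trans (leq_addr _ _); apply: subset_leq_card.
by apply/subsetP => x xT; rewrite !inE; case: (x \in endpoints F); rewrite //= xT.
Qed.

Definition exchange T load F G : Prop :=
  [/\ admissible T load F, admissible T load G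
    & exists p q H, perm_eq F (p :: H) /\ perm_eq G (q :: H)].

Definition exchange_path T load := clos_refl_trans _ (exchange T load).

Lemma exchange_path_head T load p q F :
  admissible T load (p :: F) -> admissible T load (q :: F) ->
  exchange_path T load (p :: F) (q :: F).
Proof. by move=> ap aq; apply: rt_step; split=> //; exists p, q, F. Qed.

Lemma exchange_path_perm T load F G :
  admissible T load F -> perm_eq F G -> exchange_path T load F G.
Proof.
move=> aF FG; case: F => [|p F] in aF FG *.
  by move: FG; rewrite perm_sym => /perm_nilP->; apply: rt_refl.
apply: rt_step; split; first by [].
  by rewrite -(perm_admissible _ _ FG).
by exists p, p, F; rewrite perm_refl perm_sym.
Qed.

Lemma exchange_path_sym T load F G : exchange_path T load F G -> exchange_path T load G F.
Proof.
elim=> [{}F {}G [aF aG [p [q [H [FH GH]]]]]|{}F|F1 F2 F3 _ IH12 _ IH23].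
- by apply: rt_step; split=> //; exists q, p, H.
- exact: rt_refl.
- exact: rt_trans IH23 IH12.
Qed.

Lemma exchange_path_admissible T load F G :
  exchange_path T load F G -> admissible T load F -> admissible T load G.
Proof. by elim=> [{}F {}G []|//|F1 F2 F3 _ IH12 _ IH23 /IH12/IH23]. Qed.

Lemma exchange_path_size T load F G : exchange_path T load F G -> size F = size G.
Proof.
elim=> [{}F {}G [_ _ [p [q [H [FH GH]]]]]|//|F1 F2 F3 _ -> _ //].
by rewrite (perm_size FH) (perm_size GH).
Qed.

Lemma exchange_path_cons T load p F G :
  p.1 != p.2 -> p.1 \in T -> p.2 \in T ->
  exchange_path (T :\ p.1 :\ p.2) (add_pair u p load) F G ->
  exchange_path T load (p :: F) (p :: G).
Proof.
move=> np p1T p2T; elim=> [{}F {}G [aF aG [q [r [H [FH GH]]]]]|{}F|F1 F2 F3 _ IH12 _ IH23].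
- apply: rt_step; rewrite /exchange !admissible_cons np p1T p2T; split=> //.
  exists q, r, (p :: H).
  by split; apply: perm_trans (perm_swap2 p _ H); rewrite perm_cons.
- exact: rt_refl.
- exact: rt_trans IH12 IH23.
Qed.

Lemma exchange_path_rem T load F f p : f \in F ->
  admissible T load F -> admissible T load (p :: rem f F) ->
  exchange_path T load F (p :: rem f F).
Proof.
move=> fF aF ap; apply: rt_step; split=> //.
by exists f, p, (rem f F); rewrite perm_to_rem.
Qed.

Lemma exchange_path_pull T load F x : admissible T load F -> x \in endpoints F ->
  exists y G, [/\ exchange_path T load F ((x, y) :: G), admissible T load ((x, y) :: G)
                & endpoints F =i endpoints ((x, y) :: G)].
Proof.
move=> aF /endpointsP[[a b] pF xp]; set G := rem (a, b) F.
have FG : perm_eq F ((a, b) :: G) by apply: perm_to_rem.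
have aG : admissible T load ((a, b) :: G) by rewrite -(perm_admissible _ _ FG).
have FGpath : exchange_path T load F ((a, b) :: G) by apply: exchange_path_perm.
have FGmem := perm_mem (perm_endpoints FG).
move: xp; rewrite !inE => /orP[]/eqP->; first by exists b, G.
exists a, G; rewrite admissible_swap; split=> //.
  by apply: rt_trans FGpath _; apply: exchange_path_head; rewrite // admissible_swap.
by move=> z; rewrite FGmem !inE orbCA.
Qed.

Lemma pairing_cons_free T F x y : pairing T F -> x \in free T F -> y \in free T F ->
  x != y -> pairing T ((x, y) :: F).
Proof. by rewrite pairing_cons !inE => -> /andP[-> ->] /andP[-> ->] ->. Qed.

Lemma ex_pair_outside T load F Z :
  tight k (pair_load load F) Z -> Z != set0 ->
  load Z + #|[set x in T | u x \in Z]| <= k * #|Z| ->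
  {in free T F, forall x, u x \in Z} -> k + size F < #|T| ->
  exists2 p, p \in F & (u p.1 \notin Z) && (u p.2 \notin Z).
Proof.
move=> /eqP; rewrite pair_loadE -card_gt0 => tZ Z0 loadZ freeZ ltT; apply/hasP.
apply: contraTT ltT => noPair; rewrite -leqNgt.
have countF : count (fun x => u x \notin Z) (endpoints F) +
              count (fun p => inside u p Z) F <= size F.
  elim: F noPair {tZ freeZ} => // p F IH; rewrite endpoints_cons /= negb_or => /andP[np /IH].
  by rewrite /inside; move: np; case: (u p.1 \in Z); case: (u p.2 \in Z) => //= _; lia.
have outside : #|[set x in T | u x \notin Z]| <= count (fun x => u x \notin Z) (endpoints F).
  rewrite -size_filter; apply: leq_trans (card_size _); apply: subset_leq_card.
  apply/subsetP => x; rewrite inE mem_filter => /andP[xT nx]; rewrite nx.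
  by apply: contraR nx => xF; apply: freeZ; rewrite inE xT.
have := cardsID [set x | u x \in Z] T.
rewrite -setIdE (_ : T :\: _ = [set x in T | u x \notin Z]); last first.
  by apply/setP => x; rewrite !inE andbC.
by move: tZ loadZ; rewrite -{2}(prednK Z0) mulnS; lia.
Qed.

Lemma admissible_regroup T load a b x y F Z : supermodular load ->
  admissible T load ((a, b) :: F) ->
  x \in free T ((a, b) :: F) -> y \in free T ((a, b) :: F) -> x != y ->
  maximal_tight k (pair_load load ((a, b) :: F)) Z -> u x \in Z -> u y \in Z ->
  u a \notin Z -> u b \notin Z ->
  sparse_load k (pair_load load ((b, x) :: F)) ->
  admissible T load [:: (a, y), (b, x) & F].
Proof.
move=> super /andP[pF sF] xf yf nxy maxZ xZ yZ aZ bZ sbx; apply/andP; split; last first.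
  exact: (sparse_load_regroup (supermodular_pair_load F super) sF maxZ xZ yZ aZ bZ sbx).
move: xf yf pF; rewrite !inE !pairing_cons /= !inE !negb_or.
move=> /and4P[xT xa xb xF] /and4P[yT ya yb yF] /and5P[ab aT bT aF /andP[bF pF]].
by rewrite aT yT bT xT aF bF xF yF pF ab (eq_sym b x) xb (eq_sym a x) xa (eq_sym a y) ya
  yb (eq_sym y x) nxy.
Qed.

Lemma free_pair_or_maximal_tight T load F :
  supermodular load -> sparse_load k (pair_load load F) -> 1 < #|free T F| ->
  (exists x y, [/\ x \in free T F, y \in free T F, x != y
                 & sparse_load k (pair_load load ((x, y) :: F))]) \/
  exists2 Z, maximal_tight k (pair_load load F) Z & {in free T F, forall x, u x \in Z}.
Proof.
move=> super sF /card_gt1P[x0 [x1 [x0f x1f n01]]].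
have superF := supermodular_pair_load F super.
have [/exists_inP[y yf /andP[n0y s0y]]|/exists_inPn blocked] :=
    boolP [exists y in free T F, (x0 != y) && sparse_load k (pair_load load ((x0, y) :: F))].
  by left; exists x0, y.
have {}blocked y : y \in free T F -> x0 != y ->
    exists2 Y, tight k (pair_load load F) Y & inside u (x0, y) Y.
  move=> yf n0y; apply: sparse_load_blocked sF _.
  by have := blocked y yf; rewrite n0y.
pose tight0 Y := tight k (pair_load load F) Y && (u x0 \in Y).
have [Y1 tY1 /andP[/= x0Y1 _]] := blocked _ x1f n01.
have tight0Y1 : tight0 Y1 by rewrite /tight0 tY1.
have [Z /maxsetP[/andP[tZ x0Z] maxZ] _] := maxset_exists tight0Y1.
have {}maxZ Y : tight k (pair_load load F) Y -> Z \subset Y -> Y = Z.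
  by move=> tY ZY; apply: maxZ; rewrite // /tight0 tY (subsetP ZY).
right; exists Z => // y yf; have [<-//|n0y] := eqVneq x0 y.
have [Y tY /andP[/= x0Y yY]] := blocked y yf n0y.
by rewrite -(maxZ _ (tightU superF sF tZ tY x0Z x0Y) (subsetUl _ _)) inE yY orbT.
Qed.

Lemma admissible_extend T load F : supermodular load ->
  (forall X, X != set0 -> load X + #|[set x in T | u x \in X]| <= k * #|X|) ->
  #|T| <= 2 * k -> k + size F < #|T| -> admissible T load F ->
  exists2 G, admissible T load G & size G = (size F).+1.
Proof.
move=> super loadT leT ltT aF; have /andP[pF sF] := aF.
have free2 : 1 < #|free T F| by have := card_free T F; lia.
have [[x [y [xf yf nxy sxy]]]|[Z maxZ freeZ]] := free_pair_or_maximal_tight super sF free2.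
  by exists ((x, y) :: F); rewrite // /admissible sxy pairing_cons_free.
have /card_gt1P[x [y [xf yf nxy]]] := free2.
have Z0 : Z != set0 by apply/set0Pn; exists (u x); apply: freeZ.
have [[a b] abF /andP[/= aZ bZ]] := ex_pair_outside maxZ.1 Z0 (loadT Z Z0) freeZ ltT.
pose H := rem (a, b) F; have FH : perm_eq F ((a, b) :: H) by apply: perm_to_rem.
have regroup c d : admissible T load ((c, d) :: H) ->
    pair_load load F =1 pair_load load ((c, d) :: H) ->
    endpoints F =i endpoints ((c, d) :: H) -> u c \notin Z -> u d \notin Z ->
    sparse_load k (pair_load load ((d, x) :: H)) ->
    exists2 G, admissible T load G & size G = (size F).+1.
  move=> acd loadcd endcd cZ dZ sdx; exists [:: (c, y), (d, x) & H]; last first.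
    by rewrite (perm_size FH).
  have freeH : free T F = free T ((c, d) :: H).
    by apply/setP => z; rewrite in_set endcd in_set.
  have maxZ' := eq_maximal_tight loadcd maxZ.
  by apply: (admissible_regroup super acd _ _ nxy maxZ' _ _ cZ dZ sdx);
    rewrite -?freeH ?freeZ.
have aH : admissible T load ((a, b) :: H) by rewrite -(perm_admissible _ _ FH).
have loadH := perm_pair_load load FH; have endH := perm_mem (perm_endpoints FH).
have /andP[_ sH] := aH; have superH := supermodular_pair_load H super.
case/orP: (sparse_load_alt superH (sparse_load_pair sH) x sH) => sx; last exact: (regroup a b).
apply: (regroup b a) => //; first by rewrite admissible_swap.
  by move=> Y; rewrite loadH; apply: add_pair_swap.
by move=> z; rewrite endH !inE orbCA.
Qed.

Lemma ex_admissible T load s : supermodular load -> sparse_load k load ->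
  (forall X, X != set0 -> load X + #|[set x in T | u x \in X]| <= k * #|X|) ->
  #|T| <= 2 * k -> s <= #|T| - k -> exists2 F, admissible T load F & size F = s.
Proof.
move=> super sp loadT leT; elim: s => [_|s IH lts]; first by exists [::].
have [F aF sF] := IH (ltnW lts).
by rewrite -sF; apply: admissible_extend; rewrite // sF -ltn_subRL.
Qed.

Lemma exchange_path_second T load p q r F :
  admissible T load [:: p, q & F] -> admissible T load [:: p, r & F] ->
  exchange_path T load [:: p, q & F] [:: p, r & F].
Proof.
move=> aq ar; apply: rt_step; split=> //; exists q, r, (p :: F).
by split; apply: perm_swap2.
Qed.

Lemma ex_blocking_pair load F Q x y : supermodular load ->
  sparse_load k (pair_load load F) -> ~~ sparse_load k (pair_load load ((x, y) :: F)) ->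
  sparse_load k (pair_load load ((x, y) :: Q)) ->
  exists f X, [/\ f \in F, inside u f X
    & minimal_tight u k (pair_load load (f :: rem f F)) (x, y) X].
Proof.
move=> super sF nsF /sparse_loadP sQ.
have [X minX] := ex_minimal_tight (supermodular_pair_load F super) sF nsF.
have [tX xyX _] := minX; have X0 : X != set0 by apply/set0Pn; exists (u x); case/andP: xyX.
have /hasP[f fF fX] : has (fun p => inside u p X) F.
  rewrite has_count; have := sQ X X0; rewrite -(eqP tX) /= /add_pair xyX !pair_loadE; lia.
exists f, X; split=> //; apply: eq_minimal_tight minX.
by apply: perm_pair_load; apply: perm_to_rem.
Qed.

Lemma sparse_replace load F Q x y : supermodular load -> 0 < size F ->
  sparse_load k (pair_load load F) -> sparse_load k (pair_load load ((x, y) :: Q)) ->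
  exists2 f, f \in F & sparse_load k (pair_load load ((x, y) :: rem f F)).
Proof.
move=> super F0 sF sQ; have [sxy|nsxy] := boolP (sparse_load k (pair_load load ((x, y) :: F))).
  case: F F0 sF sxy => // f F _ _ sxy; exists f; rewrite ?mem_head //= eqxx.
  by move: sxy; rewrite /= (eq_sparse_load _ (add_pairC _ _ _ _)); apply: sparse_load_pair.
have [f [X [fF fX minX]]] := ex_blocking_pair super sF nsxy sQ.
exists f => //; apply: sparse_load_exchange (supermodular_pair_load _ super) _ minX fX.
by rewrite -(eq_sparse_load k (perm_pair_load load (perm_to_rem fF))).
Qed.

Lemma exchange_path_free_pair T load F Q x y : supermodular load -> 0 < size F ->
  admissible T load F -> admissible T load ((x, y) :: Q) ->
  x \notin endpoints F -> y \notin endpoints F ->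
  exists2 G, exchange_path T load F ((x, y) :: G) & admissible T load ((x, y) :: G).
Proof.
move=> super F0 aF /andP[pQ sQ] xF yF; have /andP[pF sF] := aF.
have [f fF sxy] := sparse_replace super F0 sF sQ.
have aG : admissible T load ((x, y) :: rem f F).
  rewrite /admissible sxy andbT; move: pF xF yF pQ; have Ff := perm_to_rem fF.
  rewrite (perm_pairing T Ff) !(perm_mem (perm_endpoints Ff)) !pairing_cons endpoints_cons.
  rewrite !inE !negb_or => /and5P[_ _ _ _ /andP[_ ->]] /and3P[_ _ ->] /and3P[_ _ ->].
  by case/and5P=> -> -> ->.
by exists (rem f F) => //; apply: exchange_path_rem.
Qed.

(* The exchanges 23,45 - 13,45 - 13,24 - 35,24 - 35,12 bring in the pair 12. *)
Lemma exchange_path_circuit T load X x1 x2 x3 x4 x5 F : supermodular load ->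
  admissible T load [:: (x2, x3), (x4, x5) & F] ->
  x1 \in free T [:: (x2, x3), (x4, x5) & F] ->
  minimal_tight u k (pair_load load ((x4, x5) :: F)) (x1, x2) X -> inside u (x4, x5) X ->
  sparse_load k (pair_load load [:: (x1, x3), (x2, x4) & F]) ->
  exchange_path T load [:: (x2, x3), (x4, x5) & F] [:: (x1, x2), (x3, x5) & F].
Proof.
move=> super aF x1f minX i45 s1324; have /andP[pF s2345] := aF.
have superF := supermodular_pair_load F super; have [tX i12 _] := minX.
have s1345 := sparse_load_walk_start superF s2345 tX i12.
have [s3524 s3512] := sparse_load_walk superF s2345 minX i45 s1324.
have [p1345 p1324 p3524 p3512] : [/\ pairing T [:: (x1, x3), (x4, x5) & F],
    pairing T [:: (x1, x3), (x2, x4) & F], pairing T [:: (x3, x5), (x2, x4) & F]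
  & pairing T [:: (x3, x5), (x1, x2) & F]].
  move: pF x1f; rewrite !pairing_cons in_set !endpoints_cons !inE !negb_or -!andbA /=.
  case/and5P=> n23 x2T x3T n24 /and5P[n25 x2F n34 n35 /and5P[x3F n45 x4T x5T /and3P[x4F x5F pF]]].
  case/and5P=> x1T n12 n13 n14 /andP[n15 x1F].
  rewrite x1T x2T x3T x4T x5T x1F x2F x3F x4F x5F pF n12 n13 n14 n15 n24 n34 n35 n45.
  by rewrite !(eq_sym x5) !(eq_sym x3 x2) (eq_sym x3 x1) n13 n15 n23 n25 n45.
have a1345 : admissible T load [:: (x1, x3), (x4, x5) & F] by rewrite /admissible p1345.
have a1324 : admissible T load [:: (x1, x3), (x2, x4) & F] by rewrite /admissible p1324.
have a3524 : admissible T load [:: (x3, x5), (x2, x4) & F] by rewrite /admissible p3524.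
have a3512 : admissible T load [:: (x3, x5), (x1, x2) & F] by rewrite /admissible p3512.
apply: rt_trans (exchange_path_head aF a1345) _.
apply: rt_trans (exchange_path_second a1345 a1324) _.
apply: rt_trans (exchange_path_head a1324 a3524) _.
apply: rt_trans (exchange_path_second a3524 a3512) _.
exact: exchange_path_perm a3512 (perm_swap2 _ _ _).
Qed.

Lemma exchange_path_half_free_pair T load F Q x1 x2 x3 : supermodular load ->
  admissible T load ((x2, x3) :: F) -> admissible T load ((x1, x2) :: Q) ->
  x1 \notin endpoints ((x2, x3) :: F) ->
  exists G, exchange_path T load ((x2, x3) :: F) ((x1, x2) :: G).
Proof.
move=> super aF /andP[pQ sQ] x1F; have /andP[pF s23] := aF.
have x1T : x1 \in T by move: pQ; rewrite pairing_cons => /and5P[].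
have [s12|ns12] := boolP (sparse_load k (pair_load load ((x1, x2) :: F))).
  exists F; apply: exchange_path_head; rewrite // /admissible s12 andbT.
  move: pF pQ x1F; rewrite !pairing_cons endpoints_cons !inE !negb_or /=.
  by move=> /and5P[_ _ _ -> /andP[_ ->]] /and5P[-> -> -> _ _] /and3P[_ _ ->].
have [[a b] [X [fF fX minX]]] := ex_blocking_pair super (sparse_load_pair s23) ns12 sQ.
pose G := rem (a, b) F; rewrite -/G in minX.
have FG : perm_eq ((x2, x3) :: F) [:: (x2, x3), (a, b) & G].
  by rewrite perm_cons perm_to_rem.
have aFG : admissible T load [:: (x2, x3), (a, b) & G] by rewrite -(perm_admissible _ _ FG).
have x1f : x1 \in free T [:: (x2, x3), (a, b) & G].
  by rewrite in_set x1T -(perm_mem (perm_endpoints FG)).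
have superG := supermodular_pair_load G super.
have /andP[_ s23ab] := aFG; have [tX i12 _] := minX.
have toFG := exchange_path_perm aF FG.
case/orP: (sparse_load_walk_alt superG s23ab tX i12) => s.
  by exists ((x3, b) :: G); apply: rt_trans toFG (exchange_path_circuit super aFG x1f minX fX s).
have aba : admissible T load [:: (x2, x3), (b, a) & G].
  rewrite (perm_admissible _ _ (perm_swap2 _ _ _)) -admissible_swap.
  by rewrite (perm_admissible _ _ (perm_swap2 _ _ _)).
exists ((x3, a) :: G); apply: rt_trans toFG _.
apply: rt_trans (exchange_path_second aFG aba) _.
apply: (@exchange_path_circuit _ _ X) => //.
- move: x1f; rewrite !in_set !endpoints_cons !inE.
  by case/andP=> ->; rewrite [(x1 == a) || _]orbCA.
- by apply: eq_minimal_tight minX; apply: add_pair_swap.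
- by rewrite /inside andbC.
Qed.

Lemma exchange_path_enter T load F Q x : supermodular load ->
  admissible T load F -> admissible T load Q -> size F = size Q ->
  x \in endpoints Q -> x \notin endpoints F ->
  exists p G H, exchange_path T load F (p :: G) /\ exchange_path T load Q (p :: H).
Proof.
move=> super aF aQ sFQ xQ xF; have [y [H [QH aH eQ]]] := exchange_path_pull aQ xQ.
have F0 : 0 < size F by rewrite sFQ (exchange_path_size QH).
have [yF|yF] := boolP (y \in endpoints F); last first.
  by have [G FG _] := exchange_path_free_pair super F0 aF aH xF yF; exists (x, y), G, H.
have [z [F' [FF' aF' eF]]] := exchange_path_pull aF yF.
have xF' : x \notin endpoints ((y, z) :: F') by rewrite -eF.
have [G FG] := exchange_path_half_free_pair super aF' aH xF'.
by exists (x, y), G, H; split=> //; apply: rt_trans FF' FG.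
Qed.

Lemma exchange_path_release T load a b x F : supermodular load ->
  admissible T load ((a, b) :: F) -> x \in free T ((a, b) :: F) ->
  exists z G, [/\ exchange_path T load ((a, b) :: F) G, z \in [:: a; b] & z \notin endpoints G].
Proof.
move=> super aF; rewrite in_set endpoints_cons !inE !negb_or /= => /and4P[xT xa xb xF].
have /andP[pF sF] := aF; move: pF; rewrite pairing_cons /= => /and5P[ab aT bT aF' /andP[bF pF]].
case/orP: (sparse_load_alt (supermodular_pair_load F super) (sparse_load_pair sF) x sF) => s.
  exists b, ((a, x) :: F); rewrite !inE eqxx orbT !negb_or; split=> //.
    apply: exchange_path_head; rewrite // /admissible s pairing_cons /=.
    by rewrite eq_sym xa aT xT aF' xF pF.
  by rewrite eq_sym ab eq_sym xb.
exists a, ((b, x) :: F); rewrite !inE eqxx !negb_or; split=> //.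
  apply: exchange_path_head; rewrite // /admissible s pairing_cons /=.
  by rewrite eq_sym xb bT xT bF xF pF.
by rewrite ab eq_sym xa.
Qed.

Theorem pairings_exchange_connected T load F Q : supermodular load ->
  admissible T load F -> admissible T load Q -> size F = size Q -> 2 * size F < #|T| ->
  exchange_path T load F Q.
Proof.
move eqs: (size F) => s; elim: s => [|s IH] in T load F Q eqs *.
  by case: F eqs => // _ _ _ _ /esym/size0nil-> _; apply: rt_refl.
move=> super aF aQ sQ ltT.
have entering F' x : admissible T load F' -> size F' = s.+1 ->
    x \in endpoints Q -> x \notin endpoints F' -> exchange_path T load F' Q.
  move=> aF' sF' xQ xF'.
  have [p [G [H [FG QH]]]] := exchange_path_enter super aF' aQ (etrans sF' sQ) xQ xF'.
  apply: rt_trans (FG) (rt_trans _ _ _ _ _ _ (exchange_path_sym QH)).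
  have := exchange_path_admissible FG aF'; have := exchange_path_admissible QH aQ.
  rewrite !admissible_cons => /and4P[np p1T p2T aH] /and4P[_ _ _ aG].
  have sG : size G = s by apply: succn_inj; rewrite -sF' (exchange_path_size FG).
  have sH : s = size H by apply: succn_inj; rewrite sQ (exchange_path_size QH).
  apply: exchange_path_cons => //; apply: IH => //; first exact: supermodular_add_pair.
  move: ltT; rewrite (cardsD1 p.1 T) p1T (cardsD1 p.2 (T :\ p.1)) in_setD1 eq_sym np p2T.
  by rewrite mulnS.
have [/subsetP QF|/subsetPn[x]] := boolP (endpoints Q \subset endpoints F); last exact: entering.
case: F eqs aF QF => // -[a b] F eqs aF QF.
have [x xf] : exists x, x \in free T ((a, b) :: F).
  by apply/card_gt0P; apply: leq_trans (card_free _ _); rewrite eqs subn_gt0.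
have [z [G [FG zab zG]]] := exchange_path_release super aF xf.
have zQ : z \in endpoints Q.
  have /andP[/andP[uQ _] _] := aQ.
  have [|_ ->] := uniq_min_size uQ QF; first by rewrite !size_endpoints -sQ -eqs.
  by rewrite (mem_cat z [:: a; b]) zab.
apply: rt_trans (FG) (entering G z _ _ zQ zG); first exact: exchange_path_admissible FG aF.
by rewrite -(exchange_path_size FG).
Qed.

End Pairings.

(** * Recolouring the edges at a vertex *)

Section Star.
Variables (V E : finType) (ends : E -> V * V) (S : {set E}) (v : V).
Implicit Types (A B : {set E}) (e f g x y z : E) (w : V).

Definition star := [set e in S | ((ends e).1 == v) || ((ends e).2 == v)].

Definition off_star := S :\: star.

Definition tip e := if (ends e).1 == v then (ends e).2 else (ends e).1.

Lemma star_sub : star \subset S.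
Proof. by apply/subsetP => e; rewrite inE => /andP[]. Qed.

Lemma off_star_sub : off_star \subset S. Proof. exact: subsetDl. Qed.

Lemma off_star_notin e : e \in off_star -> e \notin star.
Proof. by rewrite inE => /andP[]. Qed.

Lemma star_off_starU : star :|: off_star = S.
Proof. by rewrite -[RHS](setID _ star) (setIidPr star_sub). Qed.

Lemma in_off_star e : e \in S -> e \notin star -> e \in off_star.
Proof. by rewrite in_setD => -> ->. Qed.

Lemma ends_star e : e \in star -> ends e = (v, tip e) \/ ends e = (tip e, v).
Proof.
rewrite inE /tip => /andP[_]; case: (ends e) => a b /=.
by have [-> _|_ /= /eqP->] := eqVneq a v; [left|right].
Qed.

Lemma tip_in (W : {set V}) e : (ends e).1 \in W -> (ends e).2 \in W -> tip e \in W.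
Proof. by rewrite /tip; case: ifP. Qed.

Lemma econnect_tip A e : e \in star ->
  econnect ends A (ends e).1 (ends e).2 = econnect ends A v (tip e).
Proof. by case/ends_star=> ->; rewrite //= econnect_sym. Qed.

Lemma econnect_star_edge A e : e \in star -> e \in A -> econnect ends A v (tip e).
Proof. by move=> es eA; rewrite -econnect_tip ?econnect_edge. Qed.

Lemma off_star_avoids : avoids ends v off_star.
Proof. by move=> e; rewrite !inE negb_and negb_or => /andP[/orP[/negbTE->|]]. Qed.

Lemma econnect_last_star_edge A w : A \subset S -> econnect ends A v w -> w <> v ->
  exists2 e, e \in A :&: star & econnect ends (A :\: star) (tip e) w.
Proof.
move=> AS vw nwv.
pose C w := (w == v) || [exists e in A :&: star, econnect ends (A :\: star) (tip e) w].
have /orP[/eqP//|/exists_inP//] : C w.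
rewrite -(econnect_closed (C := C) _ vw) /C ?eqxx // => e eA.
have [es|ns] := boolP (e \in star); last first.
  have eD : e \in A :\: star by rewrite inE ns.
  have /andP[/negbTE-> /negbTE->] : ((ends e).1 != v) && ((ends e).2 != v).
    by apply: off_star_avoids; rewrite in_off_star // (subsetP AS).
  by apply: eq_existsb => f; rewrite (econnect_eqr _ (econnect_edge ends eD)).
have te : [exists f in A :&: star, econnect ends (A :\: star) (tip f) (tip e)].
  by apply/exists_inP; exists e; [rewrite in_setI eA|apply: econnect_refl].
by have [->|->] := ends_star es; rewrite /= eqxx te orbT.
Qed.

Lemma econnect_avoid_star_edge A w : A \subset S -> 1 < #|A :&: star| ->
  econnect ends A v w -> exists2 e, e \in A :&: star & econnect ends (A :\ e) v w.
Proof.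
move=> AS /card_gt1P[x [y [xs ys nxy]]] vw; have [->|/eqP nwv] := eqVneq w v.
  by exists x; rewrite ?econnect_refl.
have [e es ew] := econnect_last_star_edge AS vw nwv.
have [f fs nef] : exists2 f, f \in A :&: star & e != f.
  by have [->|nex] := eqVneq e x; [exists y|exists x].
exists f => //; move: es fs; rewrite !in_setI => /andP[eA es] /andP[_ fs].
have ef : e \in A :\ f by rewrite in_setD1 nef.
apply: econnect_trans (econnect_star_edge es ef) _; apply: econnectS ew.
by apply: setDS; rewrite sub1set.
Qed.

Section Loopless.
Hypothesis loopless : {in S, forall e, (ends e).1 != (ends e).2}.

Lemma tip_neq e : e \in star -> tip e != v.
Proof.
move=> es; have := loopless (subsetP star_sub e es).
by have [->|->] := ends_star es; rewrite //= eq_sym.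
Qed.

Lemma forest_leaf A e : avoids ends v A -> forest ends A -> e \in star -> forest ends (e |: A).
Proof.
move=> avA fA es; apply: forest_setU1 => //; rewrite econnect_tip //.
by apply/negP => /(econnect_avoids avA)/eqP; rewrite (negbTE (tip_neq es)).
Qed.

End Loopless.

Lemma color_class_starU k (c : E -> 'I_k) i :
  color_class S c i = color_class star c i :|: color_class off_star c i.
Proof. by rewrite -{1}star_off_starU; apply/setP => e; rewrite !inE andb_orl. Qed.

Lemma card_color_class_star k (c : E -> 'I_k) i :
  #|color_class S c i| = #|color_class star c i| + #|color_class off_star c i|.
Proof.
rewrite color_class_starU cardsU disjoint_setI0 ?cards0 ?subn0 // disjoint_subset.
apply/subsetP => e; rewrite !inE => /andP[/andP[-> ->]].
by rewrite !andbT negb_and negbK.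
Qed.

End Star.

Lemma sum_card_star (V E : finType) (ends : E -> V * V) (S : {set E}) (W : {set V}) :
  \sum_(v in W) #|star ends S v| <= 2 * #|S|.
Proof.
under eq_bigr => v _ do rewrite -sum1_card.
rewrite (exchange_big_dep (mem S)) /=; last by move=> v e _; rewrite inE => /andP[].
rewrite mulnC -sum_nat_const; apply: leq_sum => e eS; rewrite sum1_card.
apply: leq_trans (_ : #|[set (ends e).1; (ends e).2]| <= 2); last first.
  by rewrite cards2; case: (_ != _).
apply: subset_leq_card; apply/subsetP => v; rewrite -topredE /= => /andP[_].
by rewrite inE => /andP[_ v_end]; rewrite !inE !(eq_sym v).
Qed.

Lemma ex_small_star (V E : finType) (ends : E -> V * V) (k : nat) (S : {set E}) (W : {set V}) :
  0 < k -> 0 < #|W| -> #|S| <= k * #|W|.-1 ->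
  exists2 v, v \in W & #|star ends S v| < 2 * k.
Proof.
move=> k_gt0 W_gt0 leS; apply/exists_inP; apply: contraTT leS => /exists_inPn big.
have : \sum_(v in W) 2 * k <= 2 * #|S|.
  by apply: leq_trans (sum_card_star ends S W); apply: leq_sum => v /big; rewrite -leqNgt.
rewrite sum_nat_const -ltnNge mulnCA leq_pmul2l //; apply: leq_trans.
by rewrite mulnC ltn_pmul2r // prednK.
Qed.

Section TightStar.
Variables (V E : finType) (ends : E -> V * V) (k : nat).
Variables (W : {set V}) (S : {set E}) (v : V).
Hypothesis k_gt2 : 2 < k.
Hypothesis vW : v \in W.
Hypothesis W_gt1 : 1 < #|W|.
Hypothesis S_within : within ends S W.
Hypothesis cardS : #|S| = k * #|W|.-1.
Hypothesis sparseS : sparse ends k S.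
Hypothesis small_star : #|star ends S v| < 2 * k.
Implicit Types (c : E -> 'I_k) (e f g x y z : E) (i j : 'I_k).
Local Notation star := (star ends S v).
Local Notation off_star := (off_star ends S v).
Local Notation tip := (tip ends v).

Let spans c i : forest_coloring ends S c ->
  {in W &, forall a b, econnect ends (color_class S c i) a b}.
Proof. by apply: tight_color_class_spans; rewrite // (ltnW W_gt1). Qed.

Lemma tip_in_W e : e \in star -> tip e \in W.
Proof. by move/(subsetP (star_sub _ _ _))/S_within => -[? ?]; apply: tip_in. Qed.

Lemma card_star_class_gt0 c i : forest_coloring ends S c -> 0 < #|color_class star c i|.
Proof.
move=> fc; have [w wW nwv] : exists2 w, w \in W & w != v.
  have /card_gt1P[a [b [aW bW nab]]] := W_gt1.
  by have [av|] := eqVneq a v; [exists b; rewrite // -av eq_sym|exists a].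
rewrite card_gt0; apply: contra_neqN nwv => /eqP c0.
apply: (econnect_avoids (avoidsS _ (@off_star_avoids _ _ ends S v))) (spans i fc vW wW).
by rewrite (color_class_starU ends S v) c0 set0U color_class_sub.
Qed.

Lemma ex_leaf_color c : forest_coloring ends S c -> exists i, #|color_class star c i| == 1.
Proof.
move=> fc; apply/existsP; apply: contraTT small_star => /existsPn no1.
rewrite -leqNgt -(sum_card_color_class star c) mulnC -[k in k * _]card_ord -sum_nat_const.
by apply: leq_sum => i _; rewrite ltn_neqAle eq_sym no1 card_star_class_gt0.
Qed.

Section AgreeOffStar.
Variables c' : E -> 'I_k.
Hypothesis fc' : forest_coloring ends S c'.

Lemma card_star_class_agree c i : forest_coloring ends S c -> {in off_star, c =1 c'} ->
  #|color_class star c i| = #|color_class star c' i|.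
Proof.
move=> fc agree; have card_tight d : forest_coloring ends S d -> #|color_class S d i| = #|W|.-1.
  by move=> fd; apply: card_tight_color_class fd; rewrite ?(ltnW W_gt1).
have := card_tight c fc; rewrite -(card_tight c' fc') !(card_color_class_star ends S v).
by rewrite (eq_color_class _ agree) => /addIn.
Qed.

(* The leaf edge [y] moves to its target class, out of which some edge at [v]
   that is misplaced there can be moved in exchange. *)
Lemma leaf_rotation c y : forest_coloring ends S c -> {in off_star, c =1 c'} ->
  y \in star -> color_class star c (c y) = [set y] -> c y != c' y ->
  exists z, [/\ z \in star, c z = c' y, c' z != c' y
    & coloring_step ends S c (swap_colors c y z)].
Proof.
move=> fc agree ys cy nyy; set l := c' y.
have yS := subsetP (star_sub _ _ _) y ys.
pose D := [set z in star | c' z != l].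
have sepD : ~~ econnect ends (color_class S c l :\: D) v (tip y).
  have yl : y \in color_class S c' l by rewrite inE yS eqxx.
  have := fc' yl; rewrite (econnect_tip _ ys); apply: contra; apply: econnectS.
  apply/subsetP => z; rewrite in_setD => /andP[zD]; rewrite in_set => /andP[zS /eqP cz].
  have nzy : z != y by apply: contraNneq nyy => zy; rewrite -{1}zy cz.
  rewrite in_setD1 nzy in_set zS /=; have [zs|/(in_off_star zS)/agree <-] := boolP (z \in star).
    by move: zD; rewrite in_set zs negbK.
  by rewrite cz.
have [z [zD zl nz]] := forest_separating_edge (fc l) (spans l fc vW (tip_in_W ys)) sepD.
have /andP[zs nzl] : (z \in star) && (c' z != l) by move: zD; rewrite in_set.
have cz : c z = l by move: zl; rewrite inE => /andP[_ /eqP].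
have zS := subsetP (star_sub _ _ _) z zs.
exists z; split=> //; apply: swap_colors_step;
  rewrite ?cz ?(econnect_tip _ ys) ?(econnect_tip _ zs) //.
have offy : color_class S c (c y) :\ y \subset off_star.
  rewrite (color_class_starU ends S v) cy setDUl setDv set0U.
  by apply: subset_trans (subD1set _ _) (color_class_sub _ _ _).
apply/negP => /(econnect_avoids (avoidsS offy (@off_star_avoids _ _ _ _ _)))/eqP.
by rewrite (negbTE (tip_neq (sparse_loopless sparseS) zs)).
Qed.

Lemma agree_off_star_path c : forest_coloring ends S c -> {in off_star, c =1 c'} ->
  coloring_path ends S c c'.
Proof.
have [n] := ubnP #|[set e in star | c e != c' e]|; elim: n c => // n IH c ltn fc agree.
have [i leaf] := ex_leaf_color fc; have leaf' := leaf.
rewrite (card_star_class_agree i fc agree) in leaf'.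
have /cards1P[y cy] := leaf; have /cards1P[x c'x] := leaf'.
have [ys /eqP ciy] : y \in star /\ c y == i.
  by apply/andP; have := set11 y; rewrite -cy inE.
have [exy|nxy] := eqVneq x y.
  apply: rt_step; split=> //; exists i.
  by rewrite !(color_class_starU ends S v) cy c'x exy (eq_color_class _ agree).
have nyy : c y != c' y.
  apply: contraNneq nxy => eyy; have : y \in color_class star c' i by rewrite inE ys -eyy ciy /=.
  by rewrite c'x inE eq_sym.
rewrite -ciy in cy; have [z [zs cz nzl step]] := leaf_rotation fc agree ys cy nyy.
have [_ fc1 _] := step; apply: rt_trans (rt_step _ _ _ _ step) (IH _ _ fc1 _); last first.
  move=> e eo; have ns := off_star_notin eo; rewrite /swap_colors /=.
  case: eqP => [ey|_]; first by rewrite ey ys in ns.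
  by case: eqP => [ez|_]; [rewrite ez zs in ns|apply: agree].
rewrite ltnS in ltn; apply: leq_trans ltn; apply: proper_card; apply/properP; split.
  apply/subsetP => e; rewrite in_set => /andP[es]; rewrite in_set es /swap_colors /=.
  have [->|_] := eqVneq e y; first by rewrite cz eqxx.
  by have [->|//] := eqVneq e z; rewrite cz (eq_sym (c' y)) nzl.
by exists y; rewrite in_set ys //= /swap_colors /= eqxx cz eqxx.
Qed.

End AgreeOffStar.

(* The component of [tip y] in its class minus [y] contains neither [v] nor the tip
   of the leaf edge, so the edge of the other class leaving it lies off the star. *)
Lemma star_unloading c i j : forest_coloring ends S c -> i != j ->
  1 < #|color_class star c i| -> #|color_class star c j| == 1 ->
  exists y g, [/\ y \in star, c y = i, g \in off_star, c g = j
    & coloring_step ends S c (swap_colors c y g)].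
Proof.
move=> fc nij i2 /cards1P[x cx]; pose A := color_class S c i; pose B := color_class S c j.
have [xs /eqP cxj] : x \in star /\ c x == j.
  by apply/andP; have := set11 x; rewrite -cx inE.
have starA d : color_class S c d :&: star = color_class star c d.
  by apply/setP => e; rewrite !inE; case: (e \in S) => //=; apply: andbC.
have [|y] := econnect_avoid_star_edge (color_class_sub S c i) _ (spans i fc vW (tip_in_W xs)).
  by rewrite starA.
rewrite starA in_set -/A => /andP[ys /eqP cy] vx.
have yS := subsetP (star_sub _ _ _) y ys.
have yA : y \in A by rewrite in_set cy yS eqxx.
have nvy : ~~ econnect ends (A :\ y) v (tip y) by rewrite -(econnect_tip _ ys); apply: fc.
pose C := econnect ends (A :\ y) (tip y).
have Cv : C v = false by apply/negbTE; rewrite /C econnect_sym.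
have Cx : C (tip x) = false by rewrite /C -(econnect_eqr _ vx).
pose D := [set g in B | C (ends g).1 != C (ends g).2].
have sepD : ~~ econnect ends (B :\: D) v (tip y).
  apply/negP => vy; have : C v = C (tip y).
    apply: econnect_closed vy => g; rewrite in_setD in_set negb_and negbK.
    by case/andP=> /orP[/negP nB /nB//|/eqP].
  by rewrite Cv /C econnect_refl.
have [g [gD gB ng]] := forest_separating_edge (fc j) (spans j fc vW (tip_in_W ys)) sepD.
have nCg : C (ends g).1 != C (ends g).2 by move: gD; rewrite in_set => /andP[].
have /andP[gS /eqP cg] : (g \in S) && (c g == j) by move: gB; rewrite in_set.
have go : g \in off_star.
  apply: in_off_star => //; apply: contra nCg => gs.
  have : g \in color_class star c j by rewrite in_set gs cg /=.
  by rewrite cx inE => /eqP->; have [->|->] := ends_star xs; rewrite /= Cv Cx.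
exists y, g; split=> //; apply: swap_colors_step; rewrite ?cy ?cg ?(econnect_tip _ ys) //.
by apply: contra nCg => gg; rewrite /C (econnect_eqr _ gg).
Qed.

Lemma coloring_path_balanced c : forest_coloring ends S c ->
  exists c1, [/\ coloring_path ends S c c1, forest_coloring ends S c1
    & forall i, #|color_class star c1 i| <= 2].
Proof.
have [n] := ubnP #|[set i | #|color_class star c i| == 1]|; elim: n c => // n IH c ltn fc.
have [/forallP le2|] := boolP [forall i, #|color_class star c i| <= 2].
  by exists c; split=> //; apply: rt_refl.
rewrite negb_forall => /existsP[i]; rewrite -ltnNge => i3; have [j j1] := ex_leaf_color fc.
have nij : i != j by apply: contraTneq i3 => ->; rewrite (eqP j1).
have [y [g [ys cy go cg step]]] := star_unloading fc nij (ltnW i3) j1.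
have yc d : y \in color_class star c d = (d == i) by rewrite in_set ys cy eq_sym.
set c1 := swap_colors c y g in step; have [_ fc1 _] := step.
have c1y : c1 y = j by rewrite /c1 /= eqxx.
have c1E e : e \in star -> e != y -> c1 e = c e.
  rewrite /c1 /= => es /negbTE->; case: eqP => // eg.
  by have := off_star_notin go; rewrite -eg es.
have sub d : color_class star c d :\ y \subset color_class star c1 d.
  apply/subsetP => e; rewrite in_setD1 in_set => /and3P[ey es ce].
  by rewrite in_set es c1E.
have j2 : 1 < #|color_class star c1 j|.
  apply/card_gt1P; have /cards1P[x cx] := j1; exists x, y.
  have : x \in color_class star c j by rewrite cx set11.
  rewrite in_set => /andP[xs cxj]; have nxy : x != y by apply: contraTneq cxj => ->; rewrite cy.
  by split=> //; rewrite in_set ?ys ?c1y ?eqxx // xs c1E.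
have [|c2 [c12 fc2 le2]] := IH c1 _ fc1; last first.
  by exists c2; split=> //; apply: rt_trans (rt_step _ _ _ _ step) c12.
rewrite ltnS in ltn; apply: leq_trans ltn; apply: proper_card; apply/properP; split.
  apply/subsetP => d; rewrite !in_set; have [->|ndj] := eqVneq d j; first by rewrite j1.
  have [->|ndi] := eqVneq d i.
    have := subset_leq_card (sub i); have := cardsD1 y (color_class star c i).
    by rewrite yc eqxx; move: i3 => ? ? ? /eqP ?; lia.
  rewrite (_ : color_class star c1 d = color_class star c d) //.
  apply/setP => e; rewrite in_set [RHS]in_set; have [->|ney] := eqVneq e y.
    by rewrite c1y cy ys eq_sym (negbTE ndj) eq_sym (negbTE ndi).
  by case es: (e \in star) => //; rewrite c1E.
by exists j; rewrite in_set // neq_ltn j2 orbT.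
Qed.

End TightStar.

(** * Splitting off pairs of edges *)

Lemma ex_injection (T1 T2 : finType) (A : {set T1}) (B : {set T2}) (y0 : T2) :
  #|A| <= #|B| ->
  exists r : T1 -> T2, {in A, forall x, r x \in B} /\ {in A &, injective r}.
Proof.
move=> leAB; exists (fun x => nth y0 (enum B) (index x (enum A))).
have ind x : x \in A -> index x (enum A) < size (enum B).
  by move=> xA; rewrite -cardE (leq_trans _ leAB) // cardE index_mem mem_enum.
split=> [x xA|x y xA yA /eqP]; first by rewrite -mem_enum mem_nth ?ind.
rewrite nth_uniq ?enum_uniq ?ind // => /eqP/(congr1 (nth x (enum A))).
by rewrite !nth_index ?mem_enum.
Qed.

Section SplitOff.
Variables (V L : finType) (k : nat).
Local Notation U := (L * (V * V))%type.
Local Notation ends := (@snd L (V * V)).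
Variables (S : {set U}) (v : V).
(* Edges are triples (label, endpoints): the pair [p] of edges at [v] is replaced by
   a new edge joining their tips, which takes over the label of [p.1]. *)
Hypothesis label_inj : {in S &, injective (@fst L (V * V))}.
Hypothesis loopless : {in S, forall e : U, (ends e).1 != (ends e).2}.
Implicit Types (A B : {set U}) (X : {set V}) (c : U -> 'I_k) (e f x y z : U) (i j : 'I_k).
Implicit Types (F G : seq (U * U)) (p q : U * U).
Local Notation star := (star ends S v).
Local Notation off_star := (off_star ends S v).
Local Notation tip := (tip ends v).

Let starS : {subset star <= S}. Proof. exact/subsetP/star_sub. Qed.
Let offS : {subset off_star <= S}. Proof. exact/subsetP/off_star_sub. Qed.

Definition splice p : U := (p.1.1, (tip p.1, tip p.2)).

Definition splices F : {set U} := [set e in map splice F].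

Definition split_off F := off_star :|: splices F.

Definition off_star_load X := #|induced ends off_star X|.

Lemma splicesP F e : reflect (exists2 p, p \in F & e = splice p) (e \in splices F).
Proof. by rewrite inE; apply: mapP. Qed.

Lemma splices_nil : splices [::] = set0.
Proof. by apply/setP => e; rewrite !inE. Qed.

Lemma splices_cons p F : splices (p :: F) = splice p |: splices F.
Proof. by apply/setP => e; rewrite !inE. Qed.

Lemma split_off_cons p F : split_off (p :: F) = splice p |: split_off F.
Proof. by rewrite /split_off splices_cons setUCA. Qed.

Lemma eq_split_off F G : F =i G -> split_off F = split_off G.
Proof.
move=> FG; congr (_ :|: _); apply/setP => e.
by apply/splicesP/splicesP => -[p pF ->]; exists p; rewrite // ?FG // -FG.
Qed.

Lemma splice_notin_S p : p.1 \in star -> p.2 \in star -> splice p \notin S.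
Proof.
move=> p1 p2; apply/negP => pS.
have e : splice p = p.1 by apply: label_inj => //; apply: starS.
have : splice p \in star by rewrite e.
by rewrite in_set /= !(negbTE (tip_neq loopless _)) ?andbF.
Qed.

Section Pairing.
Variable F : seq (U * U).
Hypothesis pF : pairing star F.

Lemma splice_inj : {in F &, injective splice}.
Proof.
move=> p q pF' qF' [e _ _]; have [p1 _] := pairing_mem pF pF'; have [q1 _] := pairing_mem pF qF'.
have pq : p.1 = q.1.
  by apply: label_inj => //; apply: starS.
by apply: (pairing_inj (x := p.1) pF pF' qF'); rewrite ?pq inE eqxx.
Qed.

Lemma splices_notin_S e : e \in splices F -> e \notin S.
Proof. by move=> /splicesP[p /(pairing_mem pF)[p1 p2] ->]; apply: splice_notin_S. Qed.

Lemma splices_avoid e : e \in splices F -> ((ends e).1 != v) && ((ends e).2 != v).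
Proof.
by move=> /splicesP[p /(pairing_mem pF)[p1 p2] ->] /=; rewrite !(tip_neq loopless).
Qed.

Lemma split_off_avoids : avoids ends v (split_off F).
Proof. by move=> e; rewrite in_setU => /orP[/off_star_avoids|/splices_avoid]. Qed.

Lemma disjoint_splices : off_star :&: splices F = set0.
Proof.
apply/setP => e; rewrite in_setI in_set0; apply/negP => /andP[eo /splices_notin_S].
by rewrite offS.
Qed.

Lemma card_induced_split_off X :
  #|induced ends (split_off F) X| = pair_load tip off_star_load F X.
Proof.
have -> : induced ends (split_off F) X = induced ends off_star X :|: induced ends (splices F) X.
  by rewrite /induced !setIdE setIUl.
rewrite cardsU (_ : _ :&: _ = set0) ?cards0 ?subn0; last first.
  by apply/eqP; rewrite -subset0 -disjoint_splices; apply: setISS; apply: induced_sub.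
rewrite pair_loadE addnC; congr (_ + _); rewrite -size_filter -(size_map splice).
have uF : uniq [seq splice p | p <- F & inside tip p X].
  rewrite map_inj_in_uniq ?filter_uniq ?(pairing_uniq pF) // => p q.
  by rewrite !mem_filter => /andP[_ pF'] /andP[_ qF']; apply: splice_inj.
rewrite -(card_uniqP uF); apply: eq_card => e; rewrite inE.
apply/andP/mapP => [[/splicesP[p pF' ->] inX]|[p]].
  by exists p; rewrite // mem_filter pF' andbT.
by rewrite mem_filter => /andP[inX pF'] ->; split=> //; apply/splicesP; exists p.
Qed.

Lemma card_split_off : #|split_off F| = #|off_star| + size F.
Proof.
have indT A : induced ends A setT = A by apply: induced_id => e; rewrite !inE.
have := card_induced_split_off setT.
rewrite pair_loadE /off_star_load !indT addnC => ->; congr (_ + _).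
by rewrite -(count_predT F); apply: eq_count => p; rewrite /inside !inE.
Qed.

Lemma sparse_split_off :
  reflect (sparse ends k (split_off F)) (sparse_load k (pair_load tip off_star_load F)).
Proof.
by apply: (iffP (sparse_loadP _ _)) => sp X X0; have := sp X X0; rewrite card_induced_split_off.
Qed.

Lemma split_off_label_inj : {in split_off F &, injective (@fst L (V * V))}.
Proof.
have cross e p : e \in off_star -> p \in F -> e.1 <> (splice p).1.
  move=> eo pF' lab; have [p1 _] := pairing_mem pF pF'.
  have ep : e = p.1 by apply: label_inj => //; [apply: offS|apply: starS].
  by have := off_star_notin eo; rewrite ep p1.
move=> e f; rewrite !in_setU.
move=> /orP[eo|/splicesP[p pF' ->]] /orP[fo|/splicesP[q qF' ->]] lab.
- by apply: label_inj => //; apply: offS.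
- by case: (cross e q).
- by case: (cross f p).
have [p1 _] := pairing_mem pF pF'; have [q1 _] := pairing_mem pF qF'.
have pq : p.1 = q.1 by apply: label_inj => //; apply: starS.
by congr splice; apply: (pairing_inj (x := p.1) pF pF' qF'); rewrite ?pq inE eqxx.
Qed.

End Pairing.

Lemma splice_notin_split_off p F : pairing star (p :: F) -> splice p \notin split_off F.
Proof.
move=> pF; have [p1 p2] := pairing_mem pF (mem_head p F).
rewrite in_setU negb_or (contra (@offS _)) ?splice_notin_S //=.
apply/splicesP => -[q qF eqpq]; have /= /andP[/negP pnF _] := pairing_uniq pF.
by apply: pnF; rewrite (splice_inj pF (mem_head p F) _ eqpq) // in_cons qF orbT.
Qed.

Lemma split_off_within (W : {set V}) F :
  within ends S W -> pairing star F -> within ends (split_off F) (W :\ v).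
Proof.
move=> S_within pF e eF; have /andP[n1 n2] := split_off_avoids pF eF; rewrite !in_setD1 n1 n2 /=.
move: eF; rewrite in_setU => /orP[/offS/S_within //|].
move=> /splicesP[p /(pairing_mem pF)[p1 p2] ->] /=.
have [a1 a2] := S_within _ (starS p1); have [b1 b2] := S_within _ (starS p2).
by split; apply: tip_in.
Qed.

Lemma supermodular_off_star_load : supermodular off_star_load.
Proof. by move=> X Y; apply: card_induced_super. Qed.

(* A new edge is a bridge between the tips of its pair, so [v] is cut off from one of the
   two tips, and the edge at [v] with that tip can take its place. *)
Lemma forest_unsplice F B : pairing star F -> B \subset S -> forest ends (B :|: splices F) ->
  exists A, [/\ {subset A <= endpoints F}, [disjoint A & B], #|A| = size F
    & forest ends (B :|: A)].
Proof.
elim: F B => [|q F IH] B pqF BS fBF.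
  exists set0; rewrite setU0 cards0 disjoint_sym -setI_eq0 setI0 eqxx; split=> //.
    by move=> x; rewrite inE.
  by apply: forestS fBF; apply: subsetUl.
have [q1 q2] := pairing_mem pqF (mem_head q F); set B' := B :|: splices F.
have pF : pairing star F by move: pqF; rewrite pairing_cons => /and5P[_ _ _ _ /andP[]].
have eB' : B :|: splices (q :: F) = splice q |: B' by rewrite splices_cons setUCA.
have qB' : splice q \notin B'.
  rewrite in_setU negb_or (contra (subsetP BS _) (splice_notin_S q1 q2)) /=.
  by apply: contra (splice_notin_split_off pqF); rewrite in_setU orbC => ->.
have fB' : forest ends B' by apply: forestS fBF; rewrite eB' subsetUr.
have nq : ~~ econnect ends B' (tip q.1) (tip q.2).
  by have := fBF (splice q); rewrite eB' setU11 setU1K //; apply.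
have [x [xs xq nx]] : exists x, [/\ x \in star, x \in endpoints (q :: F)
    & ~~ econnect ends B' v (tip x)].
  have /andP[e1 e2] := mem_endpoints (mem_head q F).
  have [vq|nvq] := boolP (econnect ends B' v (tip q.1)); [exists q.2|exists q.1]; split=> //.
  by rewrite (econnect_eql _ vq).
have xB : x \notin B by apply: contra nx => xB; apply: econnect_star_edge xs _; rewrite inE xB.
have [||A [AF dA cA fA]] := IH (x |: B) pF.
- by rewrite subUset sub1set starS.
- by rewrite -setUA; apply: forest_setU1 => //; rewrite (econnect_tip _ xs).
have xA : x \notin A by apply: contraL dA => xA; apply/pred0Pn; exists x; rewrite /= xA setU11.
exists (x |: A); split.
- by move=> y /setU1P[->//|/AF yF]; rewrite endpoints_cons !inE yF !orbT.
- rewrite -setI_eq0 setIUl setU_eq0 !setI_eq0 disjoints1 xB.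
  by apply: disjointWr dA; apply: subsetUr.
- by rewrite cardsU1 xA cA.
- by rewrite setUCA setUA.
Qed.

Definition pairs_of_color F c i := [seq p <- F | c (splice p) == i].

Lemma endpoints_pairs_of_color F c i :
  {subset endpoints (pairs_of_color F c i) <= endpoints F}.
Proof.
move=> e /endpointsP[p]; rewrite mem_filter => /andP[_ pF] ep.
by apply/endpointsP; exists p.
Qed.

Lemma pairs_of_color_disjoint F c i j e : pairing star F ->
  e \in endpoints (pairs_of_color F c i) -> e \in endpoints (pairs_of_color F c j) -> i = j.
Proof.
move=> pF /endpointsP[p]; rewrite mem_filter => /andP[/eqP<- pF'] ep.
move=> /endpointsP[q]; rewrite mem_filter => /andP[/eqP<- qF'] eq.
by rewrite (pairing_inj pF pF' qF' ep eq).
Qed.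

Lemma color_class_split_off F c i :
  color_class (split_off F) c i = color_class off_star c i :|: splices (pairs_of_color F c i).
Proof.
rewrite /color_class !setIdE setIUl; congr (_ :|: _); apply/setP => e.
rewrite in_setI in_set; apply/andP/splicesP => [[/splicesP[p pF ->] ci]|[p]].
  by exists p; rewrite // mem_filter ci.
by rewrite mem_filter => /andP[ci pF] ->; split=> //; apply/splicesP; exists p.
Qed.

Lemma sum_size_pairs_of_color F c : \sum_i size (pairs_of_color F c i) = size F.
Proof.
rewrite -[RHS](count_predT F) -sum1_count (partition_big (fun p => c (splice p)) predT) //=.
by apply: eq_bigr => i _; rewrite size_filter -sum1_count.
Qed.

Section Lift.
Variables (F : seq (U * U)) (c : U -> 'I_k).
Hypothesis pF : pairing star F.
Hypothesis fc : forest_coloring ends (split_off F) c.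

(* A seat of a colour is a set of edges at [v] by which its class can be extended
   to [S], of the size needed to make up for the removal of its new edges. *)
Definition seat i A := [/\ A \subset star, forest ends (color_class off_star c i :|: A),
    #|A| = (size (pairs_of_color F c i)).+1
  & {in A, forall e, e \in endpoints F -> e \in endpoints (pairs_of_color F c i)}].

Lemma forest_off_star_class i : forest ends (color_class off_star c i).
Proof. by apply: forestS (@fc i); rewrite color_class_split_off subsetUl. Qed.

Lemma seat_of_pairs i : pairs_of_color F c i != [::] ->
  exists2 A, seat i A & {subset A <= endpoints (pairs_of_color F c i)}.
Proof.
set Fi := pairs_of_color F c i => Fi0; have pFi : pairing star Fi by apply: pairing_filter.
have [p pFi'] : exists p, p \in Fi.
  by move: Fi0; case: (Fi) => // p s _; exists p; apply: mem_head.
have [p1 _] := pairing_mem pFi pFi'; pose B := p.1 |: color_class off_star c i.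
have BS : B \subset S.
  rewrite subUset sub1set starS //; apply: subset_trans (color_class_sub _ _ _) _.
  exact: off_star_sub.
have fB : forest ends (B :|: splices Fi).
  rewrite -setUA -color_class_split_off; apply: (forest_leaf loopless _ (@fc i) p1).
  by apply: avoidsS (color_class_sub _ _ _) _; apply: split_off_avoids.
have [A [AF dA cA fA]] := forest_unsplice pFi BS fB.
have pA : p.1 \notin A by apply: contraL dA => pA; apply/pred0Pn; exists p.1; rewrite /= pA setU11.
have sub : {subset p.1 |: A <= endpoints Fi}.
  by move=> z /setU1P[->|/AF //]; have /andP[] := mem_endpoints pFi'.
exists (p.1 |: A) => //; split=> [|||e /sub //]; last by rewrite cardsU1 pA cA.
  apply/subsetP => z /sub; have /andP[_ /allP] := pFi; exact.
by rewrite setUCA setUA.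
Qed.

Lemma ex_seat i : 2 * size F < #|star| -> exists A, seat i A.
Proof.
move=> ltF; have [Fi0|Fi0] := eqVneq (pairs_of_color F c i) [::]; last first.
  by have [A] := seat_of_pairs Fi0; exists A.
have [x] : exists x, x \in free star F.
  by apply/card_gt0P; apply: leq_trans (card_free _ _); rewrite subn_gt0.
rewrite in_set => /andP[xs xF]; exists [set x]; split; rewrite ?sub1set ?cards1 ?Fi0 //.
  rewrite setUC; apply: (forest_leaf loopless _ (@forest_off_star_class i) xs).
  by apply: avoidsS (color_class_sub _ _ _) _; apply: off_star_avoids.
by move=> e /set1P->; rewrite (negbTE xF).
Qed.

Lemma ex_distinct_empty_seats (f : 'I_k -> {set U}) : 0 < k -> #|star| <= size F + k ->
  (forall i, f i \subset star) -> (forall i j e, e \in f i -> e \in f j -> i = j) ->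
  (forall i, #|f i| + (f i == set0) = (size (pairs_of_color F c i)).+1) ->
  exists r : U -> 'I_k, {in star :\: \bigcup_i f i, forall e, f (r e) = set0} /\
    {in star :\: \bigcup_i f i &, injective r}.
Proof.
move=> k_gt0 leF fstar fdis fcard.
have [|r [r_empty r_inj]] := @ex_injection _ _ (star :\: \bigcup_i f i)
    [set i | f i == set0] (Ordinal k_gt0).
  rewrite cardsDS; last by apply/bigcupsP => i _; apply: fstar.
  have -> : #|\bigcup_i f i| = \sum_i #|f i|.
    have [col colE] := coloring_of_family k_gt0 fdis.
    by rewrite -(sum_card_color_class _ col); apply: eq_bigr => i _; rewrite colE.
  have -> : #|[set i | f i == set0]| = \sum_i (f i == set0).
    by rewrite -sum1_card big_mkcond; apply: eq_bigr => i _; rewrite inE; case: eqP.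
  rewrite leq_subLR -big_split /= (eq_bigr _ (fun i _ => fcard i)).
  under eq_bigr do rewrite -addn1.
  by rewrite big_split /= sum_size_pairs_of_color sum_nat_const card_ord muln1.
by exists r; split=> // e /r_empty; rewrite inE => /eqP.
Qed.

Lemma ex_star_partition (f : 'I_k -> {set U}) : 0 < k -> #|star| <= size F + k ->
  (forall i, f i \subset star) -> (forall i j e, e \in f i -> e \in f j -> i = j) ->
  (forall i, #|f i| + (f i == set0) = (size (pairs_of_color F c i)).+1) ->
  exists T : 'I_k -> {set U}, [/\ \bigcup_i T i = star,
    forall i j e, e \in T i -> e \in T j -> i = j,
    forall i, f i != set0 -> T i = f i & forall i, f i = set0 -> #|T i| <= 1].
Proof.
move=> k_gt0 leF fstar fdis fcard.
have [r [rempty rinj]] := ex_distinct_empty_seats k_gt0 leF fstar fdis fcard.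
pose R := star :\: \bigcup_i f i; pose T i := f i :|: [set e in R | r e == i].
have fR i e : e \in f i -> e \notin R.
  by move=> ei; rewrite in_setD negb_and negbK; apply/orP; left; apply/bigcupP; exists i.
exists T; split=> [|i j e|i fi0|i fi0].
- apply/setP => e; apply/bigcupP/idP => [[i _ /setUP[/(subsetP (fstar i))//|]]|es].
    by rewrite in_set in_setD => /andP[/andP[_ es]].
  have [/bigcupP[i _ ei]|nf] := boolP (e \in \bigcup_i f i).
    by exists i; rewrite // inE ei.
  by exists (r e); rewrite // in_setU in_set in_setD nf es eqxx orbT.
- rewrite !in_setU ![e \in [set _ in _ | _]]in_set.
  case/orP=> [ei|/andP[eR /eqP ri]] /orP[ej|/andP[eR' /eqP rj]].
  + exact: fdis ei ej.
  + by rewrite (negbTE (fR _ _ ei)) in eR'.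
  + by rewrite (negbTE (fR _ _ ej)) in eR.
  + by rewrite -ri.
- apply/setUidPl/subsetP => e; rewrite in_set => /andP[/rempty re /eqP ri].
  by rewrite -ri re eqxx in fi0.
- rewrite /T fi0 set0U; apply/card_le1_eqP => e e'; rewrite in_set => /andP[eR /eqP ri].
  by rewrite in_set => /andP[eR' /eqP ri']; apply: rinj; rewrite ?ri ?ri'.
Qed.

Lemma ex_seated_coloring (f : 'I_k -> {set U}) : 0 < k -> #|star| <= size F + k ->
  (forall i, f i \subset star) -> (forall i j e, e \in f i -> e \in f j -> i = j) ->
  (forall i, #|f i| + (f i == set0) = (size (pairs_of_color F c i)).+1) ->
  (forall i, forest ends (color_class off_star c i :|: f i)) ->
  exists g, [/\ forest_coloring ends S g, {in off_star, g =1 c}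
    & forall i, f i != set0 -> color_class S g i = color_class off_star c i :|: f i].
Proof.
move=> k_gt0 leF fstar fdis fcard ff.
have [T [starT Tdis fT T1]] := ex_star_partition k_gt0 leF fstar fdis fcard.
have [d] := coloring_of_family k_gt0 Tdis; rewrite starT => dT.
pose g e := if e \in star then d e else c e.
have goff : {in off_star, g =1 c} by move=> e /off_star_notin/negbTE; rewrite /g => ->.
have classE i : color_class S g i = color_class off_star c i :|: T i.
  rewrite (color_class_starU ends S v) (eq_color_class _ goff) setUC -dT; congr (_ :|: _).
  by apply: eq_color_class => e es; rewrite /g es.
exists g; split=> // [i|i fi0]; last by rewrite classE fT.
rewrite classE; have [fi0|fi0] := eqVneq (f i) set0; last by rewrite fT.
have [->|[e eT]] := set_0Vmem (T i); first by rewrite setU0; apply: forest_off_star_class.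
have es : e \in star by rewrite -starT; apply/bigcupP; exists i.
have -> : T i = [set e].
  apply/setP => x; rewrite in_set1; apply/idP/eqP => [xT|->//].
  by apply/(card_le1_eqP (T1 i fi0)).
rewrite setUC; apply: (forest_leaf loopless _ (@forest_off_star_class i) es).
by apply: avoidsS (color_class_sub _ _ _) _; apply: off_star_avoids.
Qed.

Lemma lift_seat i0 A0 : 0 < k -> #|star| <= size F + k -> seat i0 A0 ->
  exists g, [/\ forest_coloring ends S g, {in off_star, g =1 c}
    & color_class S g i0 = color_class off_star c i0 :|: A0].
Proof.
move=> k_gt0 leF seat0.
have /fin_all_exists[f fP] : forall i, exists A, [/\ i = i0 -> A = A0,
    i != i0 -> {subset A <= endpoints F}
  & seat i A \/ A = set0 /\ pairs_of_color F c i = [::]].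
  move=> i; have [->|ni0] := eqVneq i i0; first by exists A0; split=> //; left.
  have [Fi0|Fi0] := eqVneq (pairs_of_color F c i) [::].
    by exists set0; split=> [/eqP|_ e|]; rewrite ?(negbTE ni0) ?inE //; right.
  have [A sA AF] := seat_of_pairs Fi0.
  exists A; split=> [/eqP|_ e /AF/endpoints_pairs_of_color //|]; last by left.
  by rewrite (negbTE ni0).
have f0 : f i0 = A0 by have [->] := fP i0.
have fends i e : e \in f i -> e \in endpoints F -> e \in endpoints (pairs_of_color F c i).
  by have [_ _ [[_ _ _ sub]|[-> _]]] := fP i; [apply: sub|rewrite inE].
have [||||g [fg gc gf]] := @ex_seated_coloring f k_gt0 leF.
- by move=> i; have [_ _ [[]//|[-> _]]] := fP i; apply: sub0set.
- move=> i j e ei ej; have [//|nij] := eqVneq i j.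
  have eF : e \in endpoints F.
    have [ii0|ni0] := eqVneq i i0; last by have [_ sub _] := fP i; apply: sub.
    by have [_ sub _] := fP j; apply: sub; rewrite // -ii0 eq_sym.
  exact: pairs_of_color_disjoint pF (fends i e ei eF) (fends j e ej eF).
- move=> i; have [_ _ [[_ _ cA _]|[-> ->]]] := fP i; last by rewrite cards0 eqxx.
  by rewrite -cards_eq0 cA addn0.
- move=> i; have [_ _ [[]//|[-> _]]] := fP i.
  by rewrite setU0; apply: forest_off_star_class.
exists g; split=> //; rewrite -f0; apply: gf.
by rewrite f0 -cards_eq0; have [_ _ ->] := seat0.
Qed.

End Lift.

Lemma lift_step F c c' : pairing star F -> 0 < k ->
  #|star| <= size F + k -> 2 * size F < #|star| -> coloring_step ends (split_off F) c c' ->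
  exists g g', [/\ {in off_star, g =1 c}, {in off_star, g' =1 c'}
    & coloring_step ends S g g'].
Proof.
move=> pF k_gt0 leF ltF [fc fc' [i eqi]]; have [A seatA] := ex_seat pF fc i ltF.
have /eq_color_classP same := eqi.
have eq_off : color_class off_star c i = color_class off_star c' i.
  by apply/eq_color_classP => e eo; apply: same; rewrite in_setU eo.
have eq_pairs : pairs_of_color F c i = pairs_of_color F c' i.
  apply: eq_in_filter => p pF'; apply: same; rewrite in_setU.
  by apply/orP; right; apply/splicesP; exists p.
have seatA' : seat F c' i A by rewrite /seat -eq_off -eq_pairs.
have [g [fg gc gi]] := lift_seat pF fc k_gt0 leF seatA.
have [g' [fg' gc' gi']] := lift_seat pF fc' k_gt0 leF seatA'.
by exists g, g'; split=> //; split=> //; exists i; rewrite gi gi' eq_off.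
Qed.

End SplitOff.

Section NashWilliams.
Variables (V L : finType) (k : nat).
Hypothesis k_gt0 : 0 < k.
Local Notation U := (L * (V * V))%type.
Local Notation ends := (@snd L (V * V)).

Lemma off_star_load_bound (S : {set U}) v X : sparse ends k S -> X != set0 ->
  off_star_load S v X + #|[set e in star ends S v | tip ends v e \in X]| <= k * #|X|.
Proof.
move=> spS X0; have bound_le : k * #|v |: X|.-1 <= k * #|X|.
  by rewrite leq_mul2l cardsU1; case: (v \in X); rewrite /= ?add0n ?leq_pred ?leqnn orbT.
apply: leq_trans bound_le; apply: leq_trans (spS _ (_ : v |: X != set0)); last first.
  by apply/set0Pn; exists v; rewrite setU11.
rewrite /off_star_load; set A := induced _ _ X; set B := [set _ in _ | _].
have -> : #|A| + #|B| = #|A :|: B|.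
  rewrite -cardsUI (_ : A :&: B = set0) ?cards0 ?addn0 //; apply/setP => e.
  rewrite in_setI in_set0; apply/negP => /andP[/(subsetP (induced_sub _ _ _))].
  by move=> /off_star_notin/negbTE nes; rewrite in_set nes.
apply: subset_leq_card; rewrite subUset; apply/andP; split; apply/subsetP => e.
  rewrite in_set => /and3P[/(subsetP (off_star_sub _ _ _)) eS e1 e2].
  by rewrite in_set eS !in_setU1 e1 e2 !orbT.
rewrite in_set => /andP[es eX]; rewrite in_set (subsetP (star_sub _ _ _) _ es) /=.
by have [->|->] := ends_star es; rewrite /= !in_setU1 eqxx eX !orbT.
Qed.

(* The theorem of Nash-Williams, by induction on the number of vertices: delete a vertex
   of degree less than [2 k] and split off as many pairs of its edges as exceed [k]. *)
Theorem sparse_forest_coloring (W : {set V}) (S : {set U}) :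
  within ends S W -> {in S &, injective (@fst L (V * V))} -> sparse ends k S ->
  exists c : U -> 'I_k, forest_coloring ends S c.
Proof.
have [n] := ubnP #|W|; elim: n W S => // n IH W S leW S_within label_inj spS.
have [W0|W_gt0] := posnP #|W|.
  exists (fun=> Ordinal k_gt0) => i e; rewrite in_set => /andP[/S_within[]].
  by rewrite (cards0_eq W0) inE.
have leS : #|S| <= k * #|W|.-1 by rewrite -(induced_id S_within); apply: spS; rewrite -card_gt0.
have [v vW degv] := ex_small_star ends k_gt0 W_gt0 leS.
have leW' : #|W :\ v| < n by move: leW; rewrite (cardsD1 v W) vW.
have [star0|star_gt0] := posnP #|star ends S v|.
  apply: (IH (W :\ v)) => // e eS; have [e1 e2] := S_within e eS.
  have /andP[n1 n2] : ((ends e).1 != v) && ((ends e).2 != v).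
    by apply: (@off_star_avoids _ _ ends S); rewrite in_off_star // (cards0_eq star0) inE.
  by rewrite !in_setD1 n1 n2.
have loopless := sparse_loopless spS.
have sp0 : sparse_load k (off_star_load S v).
  apply/sparse_loadP => X /spS; apply: leq_trans; apply: subset_leq_card.
  by apply/subsetP => e; rewrite !in_set => /andP[/andP[_ ->] ->].
have [F /andP[pF spF] sF] := ex_admissible (supermodular_off_star_load S v) sp0
  (fun X => @off_star_load_bound S v X spS) (ltnW degv) (leqnn (#|star ends S v| - k)).
have [|||c fc] := IH (W :\ v) (split_off S v F) leW'.
- exact: split_off_within.
- exact: split_off_label_inj.
- exact/sparse_split_off.
have leF : #|star ends S v| <= size F + k by rewrite sF addnC -leq_subLR.
have ltF : 2 * size F < #|star ends S v| by move: degv star_gt0; rewrite sF; lia.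
have [A seatA] := ex_seat label_inj loopless pF fc (Ordinal k_gt0) ltF.
have [g [fg _ _]] := lift_seat label_inj loopless pF fc k_gt0 leF seatA.
by exists g.
Qed.

End NashWilliams.

(** * Walking between pairings *)

Section Linking.
Variables (V L : finType) (k : nat).
Local Notation U := (L * (V * V))%type.
Local Notation ends := (@snd L (V * V)).
Variables (W : {set V}) (S : {set U}) (v : V).
Hypothesis k_gt2 : 2 < k.
Hypothesis vW : v \in W.
Hypothesis W_gt1 : 1 < #|W|.
Hypothesis S_within : within ends S W.
Hypothesis label_inj : {in S &, injective (@fst L (V * V))}.
Hypothesis cardS : #|S| = k * #|W|.-1.
Hypothesis sparseS : sparse ends k S.
Hypothesis small_star : #|star ends S v| < 2 * k.
Implicit Types (c d g : U -> 'I_k) (e f x y z a b : U) (i j : 'I_k).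
Implicit Types (F G : seq (U * U)) (p q : U * U).
Local Notation star := (star ends S v).
Local Notation off_star := (off_star ends S v).
Local Notation tip := (tip ends v).
Local Notation split_off := (split_off S v).
Local Notation splice := (splice v).
Local Notation admissible := (admissible tip k star (off_star_load S v)).

Let k_gt0 : 0 < k. Proof. exact: ltn_trans k_gt2. Qed.
Let loopless := sparse_loopless sparseS.

Let starS : {subset star <= S}. Proof. exact/subsetP/star_sub. Qed.
Let offS : {subset off_star <= S}. Proof. exact/subsetP/off_star_sub. Qed.

Definition compatible F c : Prop :=
  exists2 d, forest_coloring ends (split_off F) d & {in off_star, d =1 c}.

Lemma forest_splice c i p : forest_coloring ends S c -> p.1 != p.2 ->
  p.1 \in color_class star c i -> p.2 \in color_class star c i ->
  forest ends (splice p |: color_class off_star c i).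
Proof.
move=> fc np; rewrite !in_color_class => /andP[p1 cp1] /andP[p2 cp2].
have sub : color_class off_star c i \subset color_class S c i :\ p.1.
  apply/subsetP => e ec; rewrite in_setD1 (color_class_starU ends S v) in_setU ec orbT andbT.
  apply: contraTneq p1 => <-; apply: off_star_notin.
  exact: subsetP (color_class_sub _ _ _) _ ec.
have p1c : p.1 \in color_class S c i by rewrite in_color_class starS.
have p2c : p.2 \in color_class S c i :\ p.1.
  by rewrite in_setD1 in_color_class starS // cp2 eq_sym np.
apply: forest_setU1; first exact: forestS (subset_trans sub (subD1set _ _)) (fc i).
have := fc i _ p1c; rewrite (econnect_tip _ p1); apply: contra => tips.
apply: econnect_trans (econnect_star_edge p2 p2c) _; rewrite econnect_sym.
exact: econnectS tips.
Qed.

Lemma monochromatic_compatible F c : forest_coloring ends S c -> pairing star F ->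
  {in F, forall p, c p.1 = c p.2} -> {in F &, forall p q, c p.1 = c q.1 -> p = q} ->
  compatible F c.
Proof.
move=> fc pF mono distinct.
pose d e := c (odflt e [pick x in star | x.1 == e.1]).
have d_off : {in off_star, d =1 c}.
  move=> e eo; rewrite /d; case: pickP => // x /andP[xs /eqP xe].
  have ex : x = e by apply: label_inj => //; [apply: starS|apply: offS].
  by have := off_star_notin eo; rewrite -ex xs.
have d_splice p : p \in F -> d (splice p) = c p.1.
  move=> pF'; have [p1 _] := pairing_mem pF pF'; rewrite /d.
  case: pickP => [x /andP[xs /eqP xp]|/(_ p.1)]; last by rewrite p1 /= eqxx.
  by congr c; apply: label_inj => //; apply: starS.
exists d => // i; rewrite color_class_split_off (eq_color_class _ d_off).
have Fi p : p \in pairs_of_color v F d i -> p \in F /\ c p.1 = i.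
  by rewrite mem_filter => /andP[/eqP<- pF']; rewrite d_splice.
have uFi : uniq (pairs_of_color v F d i) by apply: pairing_uniq (pairing_filter _ pF).
case: (pairs_of_color v F d i) uFi Fi => [_ _|p Fi uF inF].
  rewrite splices_nil setU0; apply: forestS (fc i).
  by rewrite (color_class_starU ends S v) subsetUr.
have [pF' cp] := inF p (mem_head _ _); have [p1 p2] := pairing_mem pF pF'.
have -> : Fi = [::].
  case: Fi uF inF => // q Fi /= /andP[pq _] inF; have [|qF cq] := inF q.
    by rewrite !inE eqxx orbT.
  by move: pq; rewrite (distinct p q) ?cp ?cq // inE eqxx.
rewrite splices_cons splices_nil setU0 setUC.
have cp2 : c p.2 = i by rewrite -mono.
apply: (forest_splice fc (pairing_neq pF pF')).
  by rewrite in_color_class p1 cp eqxx.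
by rewrite in_color_class p2 cp2 eqxx.
Qed.

Lemma leq_card_star c : forest_coloring ends S c -> k <= #|star|.
Proof.
move=> fc; rewrite -(sum_card_color_class star c) -[X in X <= _]muln1 -[X in X * _]card_ord.
rewrite -sum_nat_const; apply: leq_sum => i _.
exact: (card_star_class_gt0 vW W_gt1 S_within cardS i fc).
Qed.

Lemma pairing_one_per_color c (two : pred 'I_k) (p : 'I_k -> U * U) :
  (forall i, two i -> [/\ (p i).1 != (p i).2, (p i).1 \in color_class star c i
                        & (p i).2 \in color_class star c i]) ->
  pairing star [seq p i | i <- enum two].
Proof.
move=> pP; have : all two (enum two) by apply/allP => i; rewrite mem_enum.
elim: (enum two) (enum_uniq two) => //= i s IH /andP[ns us] /andP[ti ts].
have [np] := pP i ti; rewrite !in_color_class => /andP[p1 /eqP c1] /andP[p2 /eqP c2].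
have notin x : c x = i -> x \notin endpoints [seq p j | j <- s].
  move=> cx; apply: contra ns => /endpointsP[_ /mapP[j js ->]].
  have [_] := pP j (allP ts j js); rewrite !in_color_class => /andP[_ /eqP c1j] /andP[_ /eqP c2j].
  by rewrite !inE => /orP[]/eqP xj; rewrite -cx xj ?c1j ?c2j.
by rewrite pairing_cons np p1 p2 !notin // IH.
Qed.

Lemma balanced_compatible c : forest_coloring ends S c ->
  (forall i, #|color_class star c i| <= 2) ->
  exists F, [/\ pairing star F, size F = #|star| - k & compatible F c].
Proof.
move=> fc le2; pose two i := #|color_class star c i| == 2.
have /card_gt0P[e0 _] : 0 < #|star| by apply: leq_trans (leq_card_star fc).
have /fin_all_exists[p pP] : forall i, exists p, two i ->
    [/\ p.1 != p.2, p.1 \in color_class star c i & p.2 \in color_class star c i].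
  move=> i; case: (boolP (two i)) => [/cards2P[x [y [nxy ->]]]|_]; last by exists (e0, e0).
  by exists (x, y); rewrite /= nxy !inE !eqxx orbT.
have pF := pairing_one_per_color pP.
have pc i : two i -> c (p i).1 = i /\ c (p i).2 = i.
  by move=> /pP[_]; rewrite !in_color_class => /andP[_ /eqP->] /andP[_ /eqP->].
exists [seq p i | i <- enum two]; split=> //.
  rewrite size_map -cardE -(sum_card_color_class star c).
  have -> : \sum_i #|color_class star c i| = \sum_(i < k) ((two i : nat) + 1).
    apply: eq_bigr => i _; rewrite /two; move: (le2 i).
    by case: #|_| (card_star_class_gt0 vW W_gt1 S_within cardS i fc) => [|[|[]]].
  rewrite big_split /= sum_nat_const card_ord muln1 addnK -sum1_card big_mkcond.
  by apply: eq_bigr => i _; rewrite -topredE /=; case: (two i).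
apply: monochromatic_compatible => // [p1 /mapP[i]|p1 p2 /mapP[i + ->] /mapP[j + ->]].
  by rewrite mem_enum => /pc[c1 c2] ->; rewrite c1 c2.
by rewrite !mem_enum => /pc[-> _] /pc[-> _] ->.
Qed.

Section Pairings.
Let s := #|star| - k.
Hypothesis IH : forall F c c', pairing star F -> size F = s ->
  forest_coloring ends (split_off F) c -> forest_coloring ends (split_off F) c' ->
  coloring_path ends (split_off F) c c'.
Hypothesis k_le_star : k <= #|star|.

Let leF F : size F = s -> #|star| <= size F + k.
Proof. by move=> ->; rewrite subnK. Qed.

Let ltF F : size F = s -> 2 * size F < #|star|.
Proof. by move=> ->; move: small_star k_le_star k_gt0; rewrite /s; lia. Qed.

Lemma ex_lift F d : pairing star F -> size F = s -> forest_coloring ends (split_off F) d ->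
  exists2 g, forest_coloring ends S g & {in off_star, g =1 d}.
Proof.
move=> pF sF fd; have [A seatA] := ex_seat label_inj loopless pF fd (Ordinal k_gt0) (ltF sF).
by have [g [fg gd _]] := lift_seat label_inj loopless pF fd k_gt0 (leF sF) seatA; exists g.
Qed.

Lemma lift_path F d d' g g' : pairing star F -> size F = s ->
  coloring_path ends (split_off F) d d' -> forest_coloring ends S g ->
  forest_coloring ends S g' -> {in off_star, g =1 d} -> {in off_star, g' =1 d'} ->
  coloring_path ends S g g'.
Proof.
move=> pF sF dd' fg fg' gd gd'; move: d dd' g fg gd.
apply: clos_refl_trans_ind_right => [|d1 d2 step IHd _] g fg gd.
  apply: (agree_off_star_path k_gt2 vW W_gt1 S_within cardS sparseS) => // e eo.
  by rewrite gd ?gd'.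
have [g1 [g2 [gd1 gd2 g12]]] :=
  lift_step label_inj loopless pF k_gt0 (leF sF) (ltF sF) step.
have [fg1 fg2 _] := g12; apply: rt_trans (IHd g2 fg2 gd2).
apply: rt_trans (rt_step _ _ _ _ g12).
by apply: (agree_off_star_path k_gt2 vW W_gt1 S_within cardS sparseS) => // e eo; rewrite gd ?gd1.
Qed.

Definition linked F G : Prop := forall c c', forest_coloring ends S c ->
  forest_coloring ends S c' -> compatible F c -> compatible G c' -> coloring_path ends S c c'.

Definition splittable F : Prop :=
  [/\ pairing star F, size F = s
    & exists d : U -> 'I_k, forest_coloring ends (split_off F) d].

Lemma linked_refl F : pairing star F -> size F = s -> linked F F.
Proof.
move=> pF sF c c' fc fc' [d fd dc] [d' fd' dc'].
by apply: (lift_path pF sF (IH pF sF fd fd')) => // e eo; rewrite ?dc ?dc'.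
Qed.

Lemma linked_trans F G H : splittable G -> linked F G -> linked G H -> linked F H.
Proof.
move=> [pG sG [d fd]] FG GH c c' fc fc' Fc Hc'; have [g fg gd] := ex_lift pG sG fd.
have Gg : compatible G g by exists d => // e eo; rewrite gd.
exact: rt_trans (FG c g fc fg Fc Gg) (GH g c' fg fc' Gg Hc').
Qed.

Lemma linked_sym F G : linked F G -> linked G F.
Proof. by move=> FG c c' fc fc' Gc Fc'; apply: coloring_path_sym; apply: FG. Qed.

Lemma not_econnect_tips p G d : pairing star (p :: G) ->
  forest_coloring ends (split_off (p :: G)) d ->
  ~~ econnect ends (color_class (split_off G) d (d (splice p))) (tip p.1) (tip p.2).
Proof.
move=> pG fd; have fresh := splice_notin_split_off label_inj loopless pG.
have := fd (d (splice p)) (splice p); rewrite split_off_cons color_class_setU1 eqxx.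
rewrite setU11 setU1K; first by apply.
by apply: contra fresh; apply: subsetP (color_class_sub _ _ _) _.
Qed.

Lemma linked_replace p q G d : splittable (p :: G) -> pairing star (q :: G) ->
  forest_coloring ends (split_off (p :: G)) d ->
  ~~ econnect ends (color_class (split_off G) d (d (splice p))) (tip q.1) (tip q.2) ->
  splittable (q :: G) /\ linked (p :: G) (q :: G).
Proof.
move=> [pG sG _] qG fd nq; have fresh := splice_notin_split_off label_inj loopless qG.
pose d' := [eta d with splice q |-> d (splice p)].
have fG i : forest ends (color_class (split_off G) d i).
  apply: forestS (fd i); rewrite split_off_cons color_class_setU1.
  by case: ifP => // _; apply: subsetUr.
have d'G : {in split_off G, d' =1 d}.
  by move=> e eG; rewrite /d' /=; case: eqP => // eq; rewrite -eq eG in fresh.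
have fd' : forest_coloring ends (split_off (q :: G)) d'.
  move=> i; rewrite split_off_cons color_class_setU1 (eq_color_class _ d'G) /= eqxx.
  by case: eqP => // <-; apply: forest_setU1.
have sqG : size (q :: G) = s by [].
split=> [|c c' fc fc' pc qc']; first by split=> //; exists d'.
have [g fg gd] := ex_lift pG sG fd.
have pg : compatible (p :: G) g by exists d => // e eo; rewrite gd.
have qg : compatible (q :: G) g.
  by exists d' => // e eo; rewrite gd // d'G // in_setU eo.
exact: rt_trans (linked_refl pG sG fc fg pc pg) (linked_refl qG sqG fg fc' qg qc').
Qed.

Lemma linked_alt a b x G : splittable ((a, b) :: G) ->
  pairing star ((a, x) :: G) -> pairing star ((b, x) :: G) ->
  (splittable ((a, x) :: G) /\ linked ((a, b) :: G) ((a, x) :: G)) \/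
  (splittable ((b, x) :: G) /\ linked ((a, b) :: G) ((b, x) :: G)).
Proof.
move=> sab pax pbx; have [pab _ [d fd]] := sab; have nab := not_econnect_tips pab fd.
have [ax|nax] := boolP (econnect ends (color_class (split_off G) d (d (splice (a, b))))
                          (tip a) (tip x)); last by left; apply: (linked_replace sab pax fd nax).
by right; apply: (linked_replace sab pbx fd); rewrite /= econnect_sym -(econnect_eql _ ax).
Qed.

Lemma linked_swap a b G : splittable ((a, b) :: G) ->
  splittable ((b, a) :: G) /\ linked ((a, b) :: G) ((b, a) :: G).
Proof.
move=> sab; have [pab _ [d fd]] := sab; have pba := pab; rewrite pairing_swap in pba.
by apply: (linked_replace sab pba fd); rewrite econnect_sym; apply: not_econnect_tips pab fd.
Qed.

Lemma linked_shared a b x G :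
  splittable ((a, b) :: G) -> splittable ((a, x) :: G) -> linked ((a, b) :: G) ((a, x) :: G).
Proof.
move=> sab sax; have [pab sG _] := sab; have [pax _ _] := sax.
have [<-|nbx] := eqVneq b x; first exact: linked_refl.
have pbx : pairing star ((b, x) :: G).
  move: pab pax; rewrite !pairing_cons nbx /=.
  by move=> /and5P[_ _ -> _ /andP[-> ->]] /and5P[_ _ -> _ /andP[-> _]].
have [[_ //]|[sbx ab_bx]] := linked_alt sab pax pbx.
have pxb := pbx; rewrite pairing_swap in pxb.
have [[_ /linked_sym //]|[sxb ax_xb]] := linked_alt sax pab pxb.
have [_ bx_xb] := linked_swap sbx.
apply: (linked_trans sbx ab_bx); apply: (linked_trans sxb bx_xb).
exact: linked_sym.
Qed.

Lemma linked_exchange p q G :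
  splittable (p :: G) -> splittable (q :: G) -> linked (p :: G) (q :: G).
Proof.
case: p q => [a b] [x y] sab sxy.
have [sba ab_ba] := linked_swap sab; have [syx xy_yx] := linked_swap sxy.
have [eax|nax] := eqVneq a x; first by rewrite -eax in sxy *; apply: linked_shared.
have [ebx|nbx] := eqVneq b x.
  by rewrite -ebx in sxy *; apply: (linked_trans sba ab_ba); apply: linked_shared.
have [pab _ _] := sab; have [pxy _ _] := sxy.
have /andP[pax pbx] : pairing star ((a, x) :: G) && pairing star ((b, x) :: G).
  move: pab pxy; rewrite !pairing_cons /= nax nbx.
  by move=> /and5P[_ -> -> -> /andP[-> ->]] /and5P[_ -> _ -> _].
have [[sx ab_x]|[sx ab_x]] := linked_alt sab pax pbx; apply: (linked_trans sx ab_x);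
  have [sx' x_x'] := linked_swap sx; apply: (linked_trans sx' x_x'); exact: linked_shared.
Qed.

Lemma admissible_splittable F : admissible F -> size F = s -> splittable F.
Proof.
move=> /andP[pF spF] sF; split=> //.
apply: (sparse_forest_coloring k_gt0 (split_off_within loopless S_within pF)).
  exact: split_off_label_inj.
exact/sparse_split_off.
Qed.

Lemma exchange_path_linked F G : admissible F -> size F = s ->
  exchange_path tip k star (off_star_load S v) F G -> linked F G.
Proof.
move=> aF sF FG; move: F FG aF sF.
apply: clos_refl_trans_ind_right => [|F1 F2 [_ aF2 [p [q [H [F1p F2q]]]]] IH2 _] aF1 sF1.
  by apply: linked_refl => //; case/andP: aF1.
have sF2 : size F2 = s by rewrite -sF1 (perm_size F1p) (perm_size F2q).
apply: (linked_trans (admissible_splittable aF2 sF2)) (IH2 aF2 sF2).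
have compat F F' c : perm_eq F F' -> compatible F c -> compatible F' c.
  by move=> FF' [d fd dc]; exists d; rewrite // -(eq_split_off S v (perm_mem FF')).
have split F F' : perm_eq F F' -> admissible F -> size F = s -> splittable F'.
  move=> FF' aF sF; apply: admissible_splittable; last by rewrite -(perm_size FF').
  by rewrite -(perm_admissible _ _ _ _ FF').
have pq := linked_exchange (split _ _ F1p aF1 sF1) (split _ _ F2q aF2 sF2).
by move=> c c' fc fc' F1c F2c'; apply: pq => //; [apply: compat F1c|apply: compat F2c'].
Qed.

End Pairings.

Lemma star_coloring_path :
  (forall F c c', pairing star F -> size F = #|star| - k ->
    forest_coloring ends (split_off F) c -> forest_coloring ends (split_off F) c' ->
    coloring_path ends (split_off F) c c') ->
  forall c c', forest_coloring ends S c -> forest_coloring ends S c' ->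
    coloring_path ends S c c'.
Proof.
move=> IH c c' fc fc'; have k_star := leq_card_star fc.
have [c1 [cc1 fc1 le1]] := coloring_path_balanced k_gt2 vW W_gt1 S_within cardS small_star fc.
have [c2 [cc2 fc2 le2]] := coloring_path_balanced k_gt2 vW W_gt1 S_within cardS small_star fc'.
have [F1 [pF1 sF1 F1c1]] := balanced_compatible fc1 le1.
have [F2 [pF2 sF2 F2c2]] := balanced_compatible fc2 le2.
apply: rt_trans cc1 _; apply: rt_trans (coloring_path_sym cc2).
have adm F d : pairing star F -> compatible F d -> admissible F.
  move=> pF [d' fd' _]; rewrite /admissible pF /=.
  by apply/(sparse_split_off k label_inj loopless pF); apply: forest_coloring_sparse fd'.
have aF1 := adm _ _ pF1 F1c1; have aF2 := adm _ _ pF2 F2c2.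
apply: (exchange_path_linked IH k_star aF1 sF1 _ fc1 fc2 F1c1 F2c2).
apply: pairings_exchange_connected => //.
- exact: supermodular_off_star_load.
- by rewrite sF1.
- by rewrite sF1; move: small_star k_star k_gt0; lia.
Qed.

End Linking.

Theorem tight_coloring_path (V L : finType) (k : nat) (W : {set V}) (S : {set L * (V * V)}) :
  2 < k -> 0 < #|W| ->
  within snd S W -> {in S &, injective (@fst L (V * V))} -> #|S| = k * #|W|.-1 ->
  forall c c' : L * (V * V) -> 'I_k,
  forest_coloring snd S c -> forest_coloring snd S c' -> coloring_path snd S c c'.
Proof.
move=> k_gt2; have k_gt0 : 0 < k by apply: ltn_trans k_gt2.
have [n] := ubnP #|W|; elim: n W S => // n IH W S leW W_gt0 S_within label_inj cardS c c' fc fc'.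
have [W1|W_gt1] := leqP #|W| 1.
  have /eqP S0 : #|S| == 0 by rewrite cardS; case: #|W| W1 => [|[]] //; rewrite muln0.
  apply: rt_step; split=> //; exists (Ordinal k_gt0).
  by apply/eq_color_classP => e; rewrite (cards0_eq S0) inE.
have [|v vW small_star] := ex_small_star snd k_gt0 W_gt0 (_ : #|S| <= _); first by rewrite cardS.
have sparseS := forest_coloring_sparse fc; have loopless := sparse_loopless sparseS.
apply: (star_coloring_path k_gt2 vW W_gt1 S_within label_inj cardS sparseS small_star _ fc fc').
move=> F d d' pF sF; have cW : #|W :\ v| = #|W|.-1 by rewrite (cardsD1 v W) vW.
apply: (IH (W :\ v)).
- by rewrite cW; case: #|W| W_gt0 leW.
- by rewrite cW; case: #|W| W_gt1 => [|[]].
- exact: split_off_within.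
- exact: split_off_label_inj.
rewrite (card_split_off label_inj loopless pF) sF cW.
have := leq_card_star vW W_gt1 S_within cardS fc; have := cardsID (star snd S v) S.
rewrite (setIidPr (star_sub _ _ _)) cardS -/(off_star snd S v).
by case: #|W| W_gt1 => [|[|w]] //= _; rewrite mulnS; lia.
Qed.

(** * Bases of the cycle matroid *)

Section CycleMatroid.
Variables (V E : finType) (ends : E -> V * V).
Implicit Types (A B C S : {set E}) (e f : E) (x y w : V).

Lemma degF_set0 w : degF ends set0 w = 0.
Proof. by rewrite /degF !(eq_card0 (A := [set _ in set0 | _])) // => e; rewrite !inE. Qed.

Lemma degF_setU1 S e w : e \notin S ->
  degF ends (e |: S) w = degF ends S w + (((ends e).1 == w) + ((ends e).2 == w)).
Proof.
move=> eS; have countU1 (a : pred E) :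
    #|[set f in e |: S | a f]| = #|[set f in S | a f]| + a e.
  rewrite (cardsD1 e [set f in e |: S | a f]) !inE eqxx /= addnC; congr (_ + _).
  apply: eq_card => f; rewrite !inE; case: (eqVneq f e) => [->|] //=.
  by rewrite (negbTE eS).
by rewrite /degF !countU1 addnACA.
Qed.

Lemma degF_gt0 S e w : e \in S -> ((ends e).1 == w) || ((ends e).2 == w) -> 0 < degF ends S w.
Proof.
by move=> eS /orP[ew|ew]; rewrite addn_gt0; apply/orP; [left|right];
  apply/card_gt0P; exists e; rewrite inE eS.
Qed.

Lemma sum_degF C (X : {set V}) : \sum_(w in X) degF ends C w =
  #|[set f in C | (ends f).1 \in X]| + #|[set f in C | (ends f).2 \in X]|.
Proof.
have count_end (g : E -> V) :
    \sum_(w in X) #|[set f in C | g f == w]| = #|[set f in C | g f \in X]|.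
  rewrite -[RHS]sum1_card (partition_big g (mem X)) /=; last by move=> f; rewrite inE => /andP[].
  apply: eq_bigr => w wX; rewrite -sum1_card; apply: eq_bigl => f; rewrite !inE.
  by case: (eqVneq (g f) w) => [->|]; rewrite ?wX ?andbT ?andbF.
by rewrite big_split /= (count_end (fun f => (ends f).1)) (count_end (fun f => (ends f).2)).
Qed.

Lemma path_edge_set A x p : path (adjF ends A) x p -> uniq (x :: p) ->
  exists S, [/\ S \subset A,
    forall w, degF ends S w + (w == x) + (w == last x p) = 2 * (w \in x :: p)
  & {in S, forall f, econnect ends S x (ends f).1}].
Proof.
elim: p x => [|z p IH] x.
  move=> _ _; exists set0; split=> [|w|f]; rewrite ?sub0set // ?inE //.
  by rewrite degF_set0 add0n addnn mul2n.
rewrite [path _ _ _]/= => /andP[/adjFP[e eA exz] pathp].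
rewrite cons_uniq => /andP[xp uz]; have [S [SA dS cS]] := IH z pathp uz.
have endsE w : ((ends e).1 == w) + ((ends e).2 == w) = (w == x) + (w == z).
  by case: exz => -> /=; rewrite !(eq_sym w) // addnC.
have eS : e \notin S.
  apply/negP => eS; have := dS x; rewrite (negbTE xp) muln0 => /eqP.
  rewrite -addnA addn_eq0 => /andP[+ _]; apply/negP; rewrite -lt0n (degF_gt0 eS) //.
  by case: exz => -> /=; rewrite eqxx ?orbT.
have cxz : econnect ends (e |: S) x z.
  by have := econnect_edge ends (setU11 e S); case: exz => -> //=; rewrite econnect_sym.
exists (e |: S); split.
- by rewrite subUset sub1set eA.
- move=> w; rewrite degF_setU1 // endsE; have := dS w.
  rewrite [last x _]/= [w \in x :: _]in_cons.
  have [->|_] /= := eqVneq w x; first by rewrite (negbTE xp) /=; clear; lia.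
  by rewrite add0n addn0.
- move=> f /setU1P[->|fS]; first by case: exz => -> //=; apply: econnect_refl.
  by apply: econnect_trans cxz (econnectS _ (cS f fS)); apply: subsetUr.
Qed.

Lemma acyclic_forest A : acyclic ends A -> forest ends A.
Proof.
move=> acA e eA; apply/negP => /connectP[p0 pp0]; case/shortenP: pp0 => p pp up _ {p0} lp.
have [S [SA dS cS]] := path_edge_set pp up.
have eS : e \notin S by apply/negP => /(subsetP SA); rewrite in_setD1 eqxx.
apply: (acA (e |: S)).
  by rewrite subUset sub1set eA (subset_trans SA (subD1set _ _)).
have cx f : f \in e |: S -> econnect ends (e |: S) (ends e).1 (ends f).1.
  move=> /setU1P[->|/cS]; first exact: econnect_refl.
  by apply: econnectS; apply: subsetUr.
split.
- by apply/set0Pn; exists e; rewrite setU11.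
- move=> w; rewrite degF_setU1 // addnA; have := dS w; rewrite -lp !(eq_sym w) => ->.
  by case: (w \in _).
- move=> f g fS gS; apply: econnect_trans (cx g gS).
  by rewrite econnect_sym; apply: cx.
Qed.

(* A cycle would meet the edge cut of a bridge in exactly one edge, although all its
   degrees are even. *)
Lemma forest_acyclic A : forest ends A -> acyclic ends A.
Proof.
move=> fA C CA [/set0Pn[e eC] deg _].
have nst := forestS CA fA eC.
pose X := [set w | econnect ends (C :\ e) (ends e).1 w].
have evenX : ~~ odd (\sum_(w in X) degF ends C w).
  elim/big_rec: _ => // w m _ even_m; rewrite oddD (negbTE even_m) addbF.
  by case/orP: (deg w) => /eqP->.
have sides : [set f in C | (ends f).1 \in X] :\ e = [set f in C | (ends f).2 \in X] :\ e.
  apply/setP => f; rewrite !in_setD1 !in_set; case: eqVneq => //= nfe.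
  case: (boolP (f \in C)) => //= fC; apply: econnect_eqr; apply: econnect_edge.
  by rewrite in_setD1 nfe.
move: evenX; rewrite sum_degF (cardsD1 e) (cardsD1 e [set f in C | (ends f).2 \in X]).
by rewrite sides !in_set eC econnect_refl (negbTE nst) /= !add0n addnn odd_double.
Qed.

Lemma acyclicP A : acyclic ends A <-> forest ends A.
Proof. by split; [apply: acyclic_forest|apply: forest_acyclic]. Qed.

Lemma is_baseP B : is_base ends B <->
  forest ends B /\ forall e, econnect ends B (ends e).1 (ends e).2.
Proof.
split=> [[/acyclicP fB maxB]|[fB spanB]].
  split=> // e; apply/negPn/negP => ne; have eB : e |: B = B.
    by apply: maxB; [apply: subsetUr|apply/acyclicP; apply: forest_setU1].
  by case/negP: ne; apply: econnect_edge; rewrite -eB setU11.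
split; first exact/acyclicP.
move=> A BA /acyclicP fA; apply/eqP; rewrite eqEsubset BA andbT; apply/subsetP => e eA.
apply: contraNT (fA e eA) => eB; apply: econnectS (spanB e).
by rewrite subsetD1 BA eB.
Qed.

Lemma card_components_n_comp A : #|components ends A setT| = n_comp (adjF ends A) predT.
Proof.
have symA : connect_sym (adjF ends A) by move=> x y; apply: econnect_sym.
pose roots_set := [set x | root (adjF ends A) x == x].
have -> : components ends A setT = component ends A @: roots_set.
  apply/eqP; rewrite eqEsubset; apply/andP; split; last by apply: imsetS; apply: subsetT.
  apply/subsetP => _ /imsetP[x _ ->]; apply/imsetP; exists (root (adjF ends A) x).
    by rewrite inE root_root.
  by apply/eqP; rewrite eq_component; apply: connect_root.
rewrite card_in_imset => [|x y]; last first.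
  rewrite !inE => /eqP rx /eqP ry /eqP; rewrite eq_component => xy.
  by rewrite -rx -ry; apply/(rootP symA).
by rewrite /n_comp_mem; apply: eq_card => x; rewrite !inE /= /roots /= andbT.
Qed.

Lemma card_base B : is_base ends B -> #|B| = cycle_rank ends.
Proof.
move=> /is_baseP[fB spanB]; rewrite /cycle_rank /ncomp -card_components_n_comp.
have -> : components ends setT setT = components ends B setT.
  apply: eq_imset => x; apply/setP => y; rewrite !inE; apply/idP/idP.
    by apply: (econnect_map (h := id)) => e _; apply: spanB.
  exact: econnectS (subsetT _).
have BT : within ends B setT by [].
by have := forest_card_components fB BT; rewrite cardsT => ->; rewrite addnK.
Qed.

End CycleMatroid.

(** * Gluing the components of a graph *)

Section Glue.
Variables (V E : finType) (ends : E -> V * V).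
Implicit Types (A B : {set E}) (e : E) (x y : V).

Definition rep x := root (adjF ends setT) x.

Lemma rep_eq x y : (rep x == rep y) = econnect ends setT x y.
Proof. by apply: root_connect => a b; apply: econnect_sym. Qed.

Lemma rep_idem x : rep (rep x) = rep x.
Proof. by apply: root_root => a b; apply: econnect_sym. Qed.

Lemma rep_edge e : rep (ends e).1 = rep (ends e).2.
Proof. by apply/eqP; rewrite rep_eq econnect_edge ?inE. Qed.

Variable r0 : V.
Hypothesis rep_r0 : rep r0 = r0.

Definition glue x := if rep x == x then r0 else x.

(* A left inverse of [glue] on the component of [x]; the other components collapse
   to its representative. *)
Definition unglue x q := if q == r0 then rep x else if rep q == rep x then q else rep x.

Definition embed e : E * (V * V) := (e, (glue (ends e).1, glue (ends e).2)).

Definition glued_vertices : {set V} := [set x | (rep x != x) || (x == r0)].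

Definition glued_edges : {set E * (V * V)} := embed @: setT.

Lemma embed_inj : injective embed. Proof. by move=> e f []. Qed.

Lemma unglue_glue x y : unglue x (glue y) = if rep y == rep x then y else rep x.
Proof.
rewrite /unglue /glue; have [ry|nry] := eqVneq (rep y) y.
  by rewrite eqxx ry; case: eqP.
by have [yr0|//] := eqVneq y r0; rewrite yr0 rep_r0 eqxx in nry.
Qed.

Lemma econnect_glue A x y :
  econnect ends A x y -> econnect snd (embed @: A) (glue x) (glue y).
Proof.
by apply: econnect_map => e eA; apply: (econnect_edge snd (imset_f embed eA)).
Qed.

Lemma econnect_unglue A x y : rep x = rep y ->
  econnect snd (embed @: A) (glue x) (glue y) -> econnect ends A x y.
Proof.
move=> xy /(econnect_map (h := unglue x) (ends' := ends) (B := A)).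
rewrite !unglue_glue -xy eqxx; apply=> _ /imsetP[e eA ->] /=.
rewrite !unglue_glue -rep_edge; case: ifP => _; last exact: econnect_refl.
exact: econnect_edge.
Qed.

Lemma embed_setD1 A e : embed @: (A :\ e) = (embed @: A) :\ embed e.
Proof.
apply/setP => f; apply/imsetP/setD1P => [[g /setD1P[nge gA] ->]|[nfe /imsetP[g gA eg]]].
  by split; [apply: contraNneq nge => /embed_inj->|apply: imset_f].
by exists g => //; apply/setD1P; split=> //; apply: contraNneq nfe => <-; rewrite eg.
Qed.

Lemma forest_embed A : forest ends A <-> forest snd (embed @: A).
Proof.
split=> [fA _ /imsetP[e eA ->]|fA e eA].
  rewrite -embed_setD1; apply: contra (fA e eA).
  by apply: econnect_unglue; apply: rep_edge.
have := fA _ (imset_f embed eA); rewrite -embed_setD1; apply: contra.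
exact: econnect_glue.
Qed.

Lemma glue_in x : glue x \in glued_vertices.
Proof. by rewrite inE /glue; case: ifP => [_|->]; rewrite ?eqxx ?orbT. Qed.

Lemma card_glued_vertices : #|glued_vertices| = (cycle_rank ends).+1.
Proof.
pose Z := [set x | rep x == x].
have cardZ : #|Z| = ncomp ends.
  by rewrite /ncomp /n_comp_mem; apply: eq_card => x; rewrite !inE /= andbT.
have -> : glued_vertices = r0 |: ~: Z by apply/setP => x; rewrite !inE orbC.
rewrite cardsU1 !inE rep_r0 eqxx /= /cycle_rank -cardZ.
by have := cardsC Z; rewrite cardT -cardE => <-; rewrite addKn.
Qed.

Lemma glued_edges_within : within snd glued_edges glued_vertices.
Proof. by move=> _ /imsetP[e _ ->]; rewrite !glue_in. Qed.

Lemma glued_edges_label_inj : {in glued_edges &, injective (@fst E (V * V))}.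
Proof. by move=> _ _ /imsetP[e _ ->] /imsetP[f _ ->] /= ->. Qed.

Section Colorings.
Variable k : nat.
Hypothesis k_gt2 : 2 < k.
Hypothesis card_edges : #|E| = k * cycle_rank ends.
Hypothesis rank_gt0 : 0 < cycle_rank ends.
Implicit Types (c : E * (V * V) -> 'I_k) (i : 'I_k) (P Q : {set {set E}}).

Definition edge_class c i := [set e | c (embed e) == i].

Definition base_family c : {set {set E}} := [set edge_class c i | i : 'I_k].

Lemma card_glued_edges : #|glued_edges| = k * #|glued_vertices|.-1.
Proof. by rewrite card_imset ?cardsT ?card_edges ?card_glued_vertices //; apply: embed_inj. Qed.

Lemma color_class_glued_edges c i : color_class glued_edges c i = embed @: edge_class c i.
Proof.
apply/setP => f; rewrite inE; apply/andP/imsetP => [[/imsetP[e _ ->] ci]|[e]].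
  by exists e; rewrite // inE.
by rewrite inE => ci ->; split=> //; apply: imset_f.
Qed.

Lemma edge_class_base c i : forest_coloring snd glued_edges c -> is_base ends (edge_class c i).
Proof.
move=> fc; apply/is_baseP; split; first by apply/forest_embed; rewrite -color_class_glued_edges.
move=> e; apply: econnect_unglue; first exact: rep_edge.
rewrite -color_class_glued_edges.
by apply: (tight_color_class_spans _ glued_edges_within card_glued_edges);
  rewrite ?card_glued_vertices ?glue_in.
Qed.

Lemma base_family_vertex c :
  forest_coloring snd glued_edges c -> kbase_vertex ends k (base_family c).
Proof.
move=> fc; split=> [|_ /imsetP[i _ ->]|].
- rewrite card_imset ?card_ord // => i j /setP eij.
  have /card_gt0P[e ei] : 0 < #|edge_class c i|.
    by rewrite (@card_base _ _ ends) //; apply: edge_class_base.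
  by have := eij e; rewrite ei inE => /esym/eqP <-; move: ei; rewrite inE => /eqP.
- exact: edge_class_base.
- apply/trivIsetP => _ _ /imsetP[i _ ->] /imsetP[j _ ->] nij.
  apply/pred0P => e /=; rewrite !inE; apply/negP => /andP[/eqP ei /eqP ej].
  by move: nij; rewrite -ei -ej eqxx.
Qed.

Lemma coloring_path_kbase_path c c' : coloring_path snd glued_edges c c' ->
  kbase_path ends k (base_family c) (base_family c').
Proof.
move: c; apply: clos_refl_trans_ind_right => [|c1 c2 [fc1 fc2 [i eqi]] IH _].
  exact: kbp_refl.
apply: kbp_step IH; split; [exact: base_family_vertex..|].
exists (edge_class c1 i); split; apply/imsetP; exists i => //.
by apply: (imset_inj embed_inj); rewrite -!color_class_glued_edges.
Qed.

Lemma cover_kbase_vertex P : kbase_vertex ends k P -> cover P = setT.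
Proof.
case=> cardP baseP /eqP disjP; apply/eqP.
rewrite eqEcard subsetT cardsT card_edges -disjP -cardP -sum_nat_const.
by apply: leq_sum => B BP; rewrite (@card_base _ _ ends) //; apply: baseP.
Qed.

Lemma vertex_base_family P : kbase_vertex ends k P ->
  exists2 c, forest_coloring snd glued_edges c & base_family c = P.
Proof.
move=> vP; have coverP := cover_kbase_vertex vP; case: vP => cardP baseP disjP.
pose b i := enum_val (cast_ord (esym cardP) i).
have bP i : b i \in P by apply: enum_valP.
have bI : injective b by move=> i j /enum_val_inj/cast_ord_inj.
have bS B : B \in P -> exists i, b i = B.
  by move=> BP; exists (cast_ord cardP (enum_rank_in BP B)); rewrite /b cast_ordK enum_rankK_in.
have disj i j a : a \in embed @: b i -> a \in embed @: b j -> i = j.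
  case/imsetP=> f fi -> /imsetP[g gj /embed_inj fg]; rewrite -fg in gj.
  by apply: bI; rewrite -(def_pblock disjP (bP i) fi) (def_pblock disjP (bP j) gj).
have [c] := coloring_of_family (ltnW (ltnW k_gt2)) disj.
have -> : \bigcup_i embed @: b i = glued_edges.
  apply/setP => a; apply/bigcupP/imsetP => [[i _ /imsetP[f _ ->]]|[f _ ->]]; first by exists f.
  have /bigcupP[_ /bS[i <-] fi] : f \in cover P by rewrite coverP.
  by exists i => //; apply: imset_f.
move=> cb; have edge_classE i : edge_class c i = b i.
  by apply: (imset_inj embed_inj); rewrite -color_class_glued_edges cb.
exists c; first by move=> i; rewrite cb; apply/forest_embed; have /is_baseP[] := baseP _ (bP i).
apply/setP => B; apply/imsetP/idP => [[i _ ->]|/bS[i <-]]; first by rewrite edge_classE.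
by exists i.
Qed.

Lemma kbase_graph_connected_of_rank_gt0 : kbase_graph_connected ends k.
Proof.
move=> P Q /vertex_base_family[c fc <-] /vertex_base_family[c' fc' <-].
apply: coloring_path_kbase_path; apply: (tight_coloring_path (W := glued_vertices)) => //.
- by rewrite card_glued_vertices.
- exact: glued_edges_within.
- exact: glued_edges_label_inj.
- exact: card_glued_edges.
Qed.

End Colorings.

End Glue.

Theorem theorem3p1 (V E : finType) (ends : E -> V * V) (k : nat) :
  3 <= k ->
  #|E| = k * cycle_rank ends ->
  kbase_graph_connected ends k.
Proof.
move=> k_gt2 cardE P Q vP vQ.
have E_gt0 : 0 < #|E|.
  rewrite lt0n; apply/negP => /eqP/card0_eq E0; case: vP => cardP _ _.
  have /card_gt1P[A [B [_ _ /eqP[]]]] : 1 < #|P| by rewrite cardP ltnW.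
  by apply/setP => e; have := E0 e.
have rank_gt0 : 0 < cycle_rank ends by move: E_gt0; rewrite cardE muln_gt0 => /andP[].
have /card_gt0P[e _] := E_gt0.
exact: (kbase_graph_connected_of_rank_gt0 (rep_idem ends (ends e).1)).
Qed.
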